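(* Let $1\le d\le D$ and let $U:\mathbb R^d\to[-\infty,\infty)$ be a utility function supported on $\mathbb R_+^d$ such that (1) $U$ is upper semi-continuous; (2) $U$ is strictly concave on $\operatorname{int}(\mathbb R_+^d)$; (3) $U$ is essentially smooth; (4) $U$ is asymptotically satiable. Let $u(x)=\sup\{\mathrm E[\tilde U(X)]:X\in\mathcal A_T^x\}$ be the value function, and assume $u(x_0)<\infty$ for some $x_0\in\operatorname{int}(\operatorname{dom}(u))$. Let $x\in\mathbb R^D$ be a given initial endowment. Then $$u(x)=\sup_{W\in\mathcal A_{T-}^x}\mathrm E[\bar U(W)],$$ where $\mathcal A_{T-}^x:=\{V_{T-}:V\in\mathcal A^x\}$ and $\bar U$ is the terminal liquidation utility functional corresponding to $U$.
   Context: Utility functions. For concave $f:\mathbb R^n\to[-\infty,\infty]$: $\operatorname{dom}(f)=\{f>-\infty\}$; $f$ is proper concave if $\operatorname{dom}(f)\neq\emptyset$ and $f<\infty$ everywhere; $\operatorname{cl}(f)$ is the function whose hypograph is the closure of the hypograph of $f$; $\partial f(x)=\{x^*: f(z)\le f(x)+\langle z-x,x^*\rangle\ \forall z\}$. For a convex cone $C$ ($\lambda C+\mu C\subseteq C$ for $\lambda,\mu\ge0$), $x'\succeq_C x$ means $x'-x\in C$. A proper concave $f:\mathbb R^n\to[-\infty,\infty)$ is a utility function if $C_f:=\operatorname{cl}(\operatorname{dom}(f))$ is a convex cone with $\mathbb R_+^n\subseteq C_f\ne\mathbb R^n$ and $f$ is increasing with respect to $\succeq_{C_f}$; $f$ is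 then said to be supported on $C_f$. $f$ is essentially smooth if $\operatorname{int}(\operatorname{dom}(f))\ne\emptyset$, $f$ is differentiable there, and $|\nabla f(x_i)|\to\infty$ whenever $(x_i)$ in $\operatorname{int}(\operatorname{dom}(f))$ converges to a boundary point of $\operatorname{int}(\operatorname{dom}(f))$. $f$ is asymptotically satiable if for all $\epsilon>0$ there is $x\in\mathbb R^n$ with $\partial(\operatorname{cl}(f))(x)\cap[0,\epsilon)^n\ne\emptyset$. The extension $\tilde U:\mathbb R^D\to[-\infty,\infty)$ is $\tilde U(x)=U(x_1,\dots,x_d)$ for $x\in\mathbb R_+^D$ and $\tilde U(x)=-\infty$ otherwise. Market. A $D\times D$ matrix $\Pi=(\pi^{ij})$ is a bid-ask matrix if $\pi^{ij}>0$, $\pi^{ii}=1$ and $\pi^{ij}\le\pi^{ik}\pi^{kj}$ for all $i,j,k$. Its solvency cone $K(\Pi)\subseteq\mathbb R^D$ is the convex cone generated by the canonical basis vectors $e^i$ and the vectors $\pi^{ij}e^i-e^j$; $K^*(\Pi)=\{w\in\mathbb R^D:\langle v,w\rangle\ge0\ \forall v\in K(\Pi)\}$. Let $(\Omega,(\mathcal F_t)_{t\in[0,T]},\mathbb P)$ be a filtered probability space satisfying the usual conditions, and $(\Pi_t)_{t\in[0,T]}$ a fixed adapted càdlàg process with values in the bid-ask matrices; write $K_\tau=K(\Pi_\tau)$, $K_{\tau-}=K(\Pi_{\tau-})$, and similarly $K_\tau^*,K_{\tau-}^*$. Standing assumptions: $\mathcal F_{T-}=\mathcal F_T$ and $\Pi_{T-}=\Pi_T$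 a.s., and $\mathcal Z^s\ne\emptyset$ ($\mathcal Z^s$ defined next). A consistent price process is an adapted $\mathbb R_+^D\setminus\{0\}$-valued càdlàg martingale $Z$ with $Z_t\in K_t^*$ a.s. for all $t\in[0,T]$; it is strictly consistent if moreover $Z_\tau\in\operatorname{int}(K_\tau^* )$ a.s. on $\{\tau<\infty\}$ for every $[0,T]\cup\{\infty\}$-valued stopping time $\tau$ and $Z_{\sigma-}\in\operatorname{int}(K_{\sigma-}^* )$ a.s. on $\{\sigma<\infty\}$ for every predictable $[0,T]\cup\{\infty\}$-valued stopping time $\sigma$. $\mathcal Z^s$ is the set of strictly consistent price processes. A self-financing portfolio process is an $\mathbb R^D$-valued predictable process $V=(V_t)_{t\in[0,T]}$ with a.e. path of finite variation (not necessarily right-continuous) such that for all stopping times $0\le\sigma\le\tau\le T$, $V_\tau-V_\sigma\in-\overline{\operatorname{conv}}(\bigcup_{\sigma\le t<\tau}K_t,0)$ a.s. (pathwise closed convex hull of the union together with $0$). It is admissible if there is $a>0$ such that $V_T+a\mathbf 1\in K_T$ a.s. and $\langle V_\tau+a\mathbf 1,Z_\tau^s\rangle\ge0$ a.s. for all $[0,T]$-valued stopping times $\tau$ and all $Z^s\in\mathcal Z^s$, where $\mathbf 1=(1,\dots,1)$. $\mathcal A^x$ is the set of admissible self-financing portfolio processes with $V_0=x$, and $\mathcal A_T^x=\{V_T:V\in\mathcal A^x\}$. Convention: the expectation of a $[-\infty,\infty)$-valued random variable is $-\infty$ whenever its negative part has infinite expectation. Liquidation. For an $\mathcal F_{T-}$-measurable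 random vector $W$ with values in $K_T$ a.s., the terminal liquidation utility functional is the random quantity $$\bar U(W):=\max\{U(\xi):\xi\in\mathbb R_+^d,\ (\xi,\underline 0)-W\in-K_T\},$$ with $\underline0$ the zero vector of $\mathbb R^{D-d}$ (the constraint set is a.s. nonempty and compact). If $W$ is not $K_T$-valued, $\bar U(W)$ is read as $-\infty$ on $\{W\notin K_T\}$, where the constraint set is empty. *)

(* Defs.v *)
From mathcomp Require Import all_boot all_order all_algebra.
From mathcomp Require Import all_classical all_reals all_analysis.

Set Implicit Arguments.
Unset Strict Implicit.
Unset Printing Implicit Defensive.

Import Order.TTheory GRing.Theory Num.Theory.
Import numFieldNormedType.Exports.

Local Open Scope classical_set_scope.
Local Open Scope ring_scope.

Section vectors.
Context {R : realType} {n : nat}.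
Implicit Types (x y : 'rV[R]_n) (A C K : set 'rV[R]_n).

Definition dotp x y : R := \sum_(i < n) x 0 i * y 0 i.

Definition enorm x : R := Num.sqrt (dotp x x).

Definition orthant : set 'rV[R]_n := [set x | forall i, 0 <= x 0 i].

Definition basis_vec (i : 'I_n) : 'rV[R]_n := delta_mx 0 i.

Definition convex_cone C :=
  forall (a b : R) x y, 0 <= a -> 0 <= b -> C x -> C y -> C (a *: x + b *: y).

Definition cone_le C x x' := C (x' - x).

Definition dual_cone K : set 'rV[R]_n :=
  [set w | forall v, K v -> 0 <= dotp v w].

Definition opp_set K : set 'rV[R]_n := [set - v | v in K].

Definition closed_convex_hull A : set 'rV[R]_n :=
  closure (smallest (@convex_set R 'rV[R]_n) A).

End vectors.

Section utility_functions.
Context {R : realType} {n : nat}.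
Implicit Types (f : 'rV[R]_n -> \bar R) (x : 'rV[R]_n).

Definition edom f : set 'rV[R]_n := [set x | (-oo < f x)%E].

(* The weights are kept in the open interval (0,1): no product 0 * -oo occurs,
   and no sum +oo - oo, since f < +oo. *)
Definition proper_concave f :=
  [/\ edom f !=set0,
      forall x, (f x < +oo)%E &
      forall x y (t : R), 0 < t < 1 ->
        (t%:E * f x + (1 - t)%:E * f y <= f (t *: x + (1 - t) *: y)%R)%E].

Definition strictly_concave_on (A : set 'rV[R]_n) f :=
  forall x y (t : R), A x -> A y -> x != y -> 0 < t < 1 ->
    (t%:E * f x + (1 - t)%:E * f y < f (t *: x + (1 - t) *: y)%R)%E.

Definition hypograph f : set ('rV[R]_n * R) := [set xa | (xa.2%:E <= f xa.1)%E].

(* The closure of a hypograph is a hypograph: that of the function below. *)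
Definition eclosure f x : \bar R :=
  ereal_sup [set a%:E | a in [set a : R | closure (hypograph f) (x, a)]].

Definition superdiff f x : set 'rV[R]_n :=
  [set xs | forall z, (f z <= f x + (dotp (z - x)%R xs)%:E)%E].

Definition support_cone f : set 'rV[R]_n := closure (edom f).

Definition utility_function f :=
  [/\ proper_concave f,
      convex_cone (support_cone f),
      orthant `<=` support_cone f,
      support_cone f != setT &
      forall x x', cone_le (support_cone f) x x' -> (f x <= f x')%E].

Definition upper_semicontinuous f := lower_semicontinuous (fun x => - f x)%E.

(* On the interior of its domain a proper concave function is finite, so that
   derivatives of the real-valued function fine \o f at such points are those
   of f. *)
Definition real_part f : 'rV[R]_n -> R^o := fun x => fine (f x).

Definition gradient f x : 'rV[R]_n :=
  \row_(i < n) 'D_(basis_vec i) (real_part f) x.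

Definition essentially_smooth f :=
  [/\ interior (edom f) !=set0,
      forall x, interior (edom f) x -> differentiable (real_part f) x &
      forall (x_ : nat -> 'rV[R]_n) (b : 'rV[R]_n),
        (forall k, interior (edom f) (x_ k)) ->
        closure (interior (edom f)) b -> ~ interior (edom f) b ->
        x_ k @[k --> \oo] --> b ->
        enorm (gradient f (x_ k)) @[k --> \oo] --> +oo].

Definition asymptotically_satiable f :=
  forall e : R, 0 < e -> exists x,
    superdiff (eclosure f) x `&` [set xs | forall i, 0 <= xs 0 i < e] !=set0.

End utility_functions.

Section bid_ask_matrices.
Context {R : realType} {D : nat}.
Implicit Types Pi : 'M[R]_D.

Definition bid_ask Pi :=
  [/\ forall i j, 0 < Pi i j,
      forall i, Pi i i = 1 &
      forall i j k, Pi i j <= Pi i k * Pi k j].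

Definition solvency_cone Pi : set 'rV[R]_D :=
  smallest convex_cone
    ([set v | exists i, v = basis_vec i] `|`
     [set v | exists i j, v = Pi i j *: basis_vec i - basis_vec j]).

Definition solvency_dual Pi : set 'rV[R]_D := dual_cone (solvency_cone Pi).

End bid_ask_matrices.

(* Processes indexed by [0,T] are functions on all of R, of which only the
   values at times in [0,T] are ever used. *)
Section processes.
Context {R : realType} {disp : measure_display} {Omega : measurableType disp}.
Variables (P : probability Omega R) (T : R) (F : R -> set (set Omega)).

Definition filtration :=
  (forall t : R, 0 <= t <= T ->
     sigma_algebra setT (F t) /\ F t `<=` @measurable _ Omega) /\
  (forall s t : R, 0 <= s -> s <= t -> t <= T -> F s `<=` F t).

Definition usual_conditions :=
  P.-negligible `<=` F 0 /\
  (forall t : R, 0 <= t < T -> F t = \bigcap_(s in `]t, T]) F s).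

Definition F_left_T : set (set Omega) := <<s \bigcup_(t in `[0, T[) F t >>.

(* Measurability on A for a sigma-algebra G on A given as a set of sets. *)
Definition measurable_wrt (E : Type) (A : set E) (G : set (set E)) (X : E -> R) :=
  forall B : set R, measurable B -> G (A `&` X @^-1` B).

Definition stopping_time (tau : Omega -> \bar R) :=
  (forall w, (0 <= tau w <= T%:E)%E \/ tau w = +oo%E) /\
  (forall t : R, 0 <= t <= T -> F t [set w | (tau w <= t%:E)%E]).

Definition bounded_stopping_time (tau : Omega -> R) :=
  stopping_time (EFin \o tau).

Definition predictable_sets : set (set (R * Omega)) :=
  <<s `[0, T] `*` setT,
    [set A | exists2 B, F 0 B & A = [set 0] `*` B] `|`
    [set A | exists (s t : R) B,
       [/\ 0 <= s, s < t, t <= T, F s B & A = `]s, t] `*` B]] >>.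

(* sigma is predictable when the stochastic interval [sigma, oo) is. *)
Definition predictable_time (sigma : Omega -> \bar R) :=
  stopping_time sigma /\
  predictable_sets [set tw : R * Omega | 0 <= tw.1 <= T /\ (sigma tw.2 <= tw.1%:E)%E].

Section matrix_valued.
Context {m n : nat}.
Implicit Types X : R -> Omega -> 'M[R]_(m, n).

Definition adapted X :=
  forall t : R, 0 <= t <= T ->
    forall i j, measurable_wrt setT (F t) (fun w => X t w i j).

Definition cadlag X := forall w,
  (forall t : R, 0 <= t < T -> X s w @[s --> t^'+] --> X t w) /\
  (forall t : R, 0 < t <= T -> cvg (X s w @[s --> t^'-])).

(* X_{t-}, with the usual convention X_{0-} = X_0. *)
Definition left_lim X (t : R) (w : Omega) : 'M[R]_(m, n) :=
  if t == 0 then X 0 w else lim (X s w @[s --> t^'-]).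

Definition predictable X := forall i j,
  measurable_wrt (`[0, T] `*` setT) predictable_sets
    (fun tw => X tw.1 tw.2 i j).

(* The last clause says E[X_t | F_s] = X_s. *)
Definition martingale X :=
  [/\ adapted X,
      forall t : R, 0 <= t <= T -> forall i j,
        P.-integrable setT (fun w => (X t w i j)%:E) &
      forall s t : R, 0 <= s -> s <= t -> t <= T -> forall A, F s A -> forall i j,
        (\int[P]_(w in A) (X t w i j)%:E = \int[P]_(w in A) (X s w i j)%:E)%E].

End matrix_valued.

Definition expect (X : Omega -> \bar R) : \bar R :=
  if (\int[P]_w (X^\- w) == +oo)%E then -oo%E else (\int[P]_w X w)%E.

End processes.

Section market.
Context {R : realType} {disp : measure_display} {Omega : measurableType disp}.
Variables (P : probability Omega R) (T : R) (F : R -> set (set Omega)).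
Context {D : nat}.
Variable Pi : R -> Omega -> 'M[R]_D.
Implicit Types Z V : R -> Omega -> 'rV[R]_D.

Definition consistent_price_process Z :=
  [/\ forall (t : R) w, 0 <= t <= T -> orthant (Z t w) /\ Z t w != 0,
      cadlag T Z,
      martingale P T F Z &
      forall t : R, 0 <= t <= T ->
        {ae P, forall w, solvency_dual (Pi t w) (Z t w)}].

Definition strictly_consistent_price_process Z :=
  [/\ consistent_price_process Z,
      forall tau, stopping_time T F tau ->
        {ae P, forall w, (tau w < +oo)%E ->
           interior (solvency_dual (Pi (fine (tau w)) w)) (Z (fine (tau w)) w)} &
      forall sigma, predictable_time T F sigma ->
        {ae P, forall w, (sigma w < +oo)%E ->
           interior (solvency_dual (left_lim Pi (fine (sigma w)) w))
             (left_lim Z (fine (sigma w)) w)}].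

Definition Zs : set (R -> Omega -> 'rV[R]_D) :=
  [set Z | strictly_consistent_price_process Z].

Definition self_financing V :=
  [/\ predictable T F V,
      {ae P, forall w, forall i, bounded_variation 0 T (fun t => V t w 0 i)} &
      forall sigma tau,
        bounded_stopping_time T F sigma -> bounded_stopping_time T F tau ->
        (forall w, sigma w <= tau w) ->
        {ae P, forall w,
           opp_set
             (closed_convex_hull
                (\bigcup_(t in `[sigma w, tau w[) solvency_cone (Pi t w)
                 `|` [set 0]))
             (V (tau w) w - V (sigma w) w)}].

Definition admissible V :=
  exists2 a : R, 0 < a &
    {ae P, forall w, solvency_cone (Pi T w) (V T w + const_mx a)} /\
    (forall tau Z, bounded_stopping_time T F tau -> Zs Z ->
       {ae P, forall w, 0 <= dotp (V (tau w) w + const_mx a) (Z (tau w) w)}).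

Definition portfolios (x : 'rV[R]_D) : set (R -> Omega -> 'rV[R]_D) :=
  [set V | [/\ self_financing V, admissible V & {ae P, forall w, V 0 w = x}]].

Definition terminal_values (x : 'rV[R]_D) : set (Omega -> 'rV[R]_D) :=
  [set V T | V in portfolios x].

Definition preterminal_values (x : 'rV[R]_D) : set (Omega -> 'rV[R]_D) :=
  [set left_lim V T | V in portfolios x].

Context {d : nat}.
Implicit Type U : 'rV[R]_d -> \bar R.

Definition extend_utility (hdD : (d <= D)%N) U (x : 'rV[R]_D) : \bar R :=
  if `[< orthant x >] then U (\row_(i < d) x 0 (widen_ord hdD i)) else -oo%E.

Definition value_function (hdD : (d <= D)%N) U (x : 'rV[R]_D) : \bar R :=
  ereal_sup [set expect P (extend_utility hdD U \o X) | X in terminal_values x].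

Definition pad0 (xi : 'rV[R]_d) : 'rV[R]_D :=
  \row_(j < D) if insub (val j) is Some i then xi 0 i else 0.

(* The supremum of the upper semicontinuous U over the almost surely compact
   constraint set is a maximum; it is -oo where the constraint set is empty,
   that is, where W is not in K_T. *)
Definition liquidation_utility U (W : Omega -> 'rV[R]_D) (w : Omega) : \bar R :=
  ereal_sup [set U xi | xi in
    [set xi | orthant xi /\ opp_set (solvency_cone (Pi T w)) (pad0 xi - W w)]].

End market.

(* Main.v *)
Require Import Defs.
From mathcomp Require Import all_boot all_order all_algebra.
From mathcomp Require Import all_classical all_reals all_analysis.
From mathcomp Require Import finmap measurable_realfun lra.

(* A portfolio may jump at T by an element of -K_{T-} = -K_T. Hence V_{T-} - V_T
   lies in K_T for every V in A^x (bipolarity, tested against perturbations by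
   the interior point Z_T of the dual cone), so that the traded assets of a
   nonnegative V_T form a liquidation of V_{T-}, and u(x) is at most the
   right-hand side.
   Conversely, an F_T-measurable liquidation xi of V_{T-} can be substituted
   for V_T without leaving A^x, because F_{T-} = F_T makes the modified process
   predictable. Such a xi with U(xi) above any prescribed F_T-measurable level
   below the liquidation utility is found by measurable selection, and monotone
   approximation of the liquidation utility by such levels gives the remaining
   inequality. *)

Set Implicit Arguments.
Unset Strict Implicit.
Unset Printing Implicit Defensive.

Import Order.TTheory GRing.Theory Num.Theory.
Import numFieldNormedType.Exports.

Local Open Scope classical_set_scope.
Local Open Scope ring_scope.

(** * Measurable selection from random zero sets *)

(** The test vector has to be perturbed because a boundary point of K_T^* need not lie in K_s^* for
    s < T, whereas adding a small multiple of an interior point makes the exchange inequalities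
    strict, hence stable under a small change of prices. A solvent position is described by finitely
    many exchange volumes. Thus an element of K_T can be approximated by trades at times just before
    T, and being a liquidation becomes a system of inequalities that is continuous in the unknowns
    and measurable in the scenario. The utility is only upper semicontinuous and may be -oo. It
    therefore enters through its closed hypograph, with the level as an additional unknown; aiming
    strictly below the supremum avoids any appeal to an optimal liquidation. Finally, V_{T-} exists
    as a limit only almost surely. Null sets belong to F_0, so it has an F_T-measurable version, and
    expectations can be compared along almost sure inequalities without assuming measurability. *)

(** The Heine-Borel property, isolated as a predicate because it passes to products; the selection
    below takes place in a product of three spaces. *)
Definition proper_space (R : realType) (E : normedModType R) :=
  forall N : R, compact [set y : E | `|y| <= N].

Lemma proper_space_R (R : realType) : proper_space R^o.
Proof.
move=> N; suff -> : [set y : R^o | `|y| <= N] = `[- N, N]%classic.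
  exact: segment_compact.
by apply/seteqP; split => y /=; rewrite in_itv /= ler_norml.
Qed.

Lemma closed_norm_le (R : realType) (E : normedModType R) (N : R) :
  closed [set y : E | `|y| <= N].
Proof.
apply: (@preimage_closed E R^o (fun y => `|y|) [set z : R | z <= N]).
  by move=> y _; exact: norm_continuous.
exact: closed_le.
Qed.

Lemma proper_space_rV (R : realType) (n : nat) : proper_space 'rV[R]_n.
Proof.
move=> N; apply: bounded_closed_compact; last exact: closed_norm_le.
exists N; split; first exact: num_real.
by move=> M NM y /= yN; apply: le_trans yN (ltW NM).
Qed.

Lemma proper_space_prod (R : realType) (E E' : normedModType R) :
  proper_space E -> proper_space E' -> proper_space (E * E')%type.
Proof.
move=> pE pE' N.
suff -> : [set y : E * E' | `|y| <= N] =
          [set y : E | `|y| <= N] `*` [set y : E' | `|y| <= N].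
  exact: compact_setX.
apply/seteqP; split => -[y z] /=.
  by rewrite prod_normE /= ge_max => /andP[].
by rewrite prod_normE /= ge_max => -[-> ->].
Qed.

Lemma compact_finite_net (R : realType) (E : normedModType R) (K : set E)
    (e : R) : 0 < e -> compact K ->
  exists F : set E, [/\ finite_set F, F `<=` K &
    forall y, K y -> exists2 q, F q & ball y e q].
Proof.
move=> e0; rewrite compact_cover => /(_ _ K (fun q => interior (ball q e))).
case.
- by move=> q _; exact: open_interior.
- by move=> y Ky; exists y => //; rewrite /interior; exact: nbhsx_ballx.
- move=> F FK KF; exists [set` F]; split; first exact: finite_fset.
    by move=> q qF; apply: set_mem; exact: FK.
  move=> y /KF[q /= qF yq]; exists q => //.
  by apply: ball_sym; exact: interior_subset yq.
Qed.

Section random_zero_sets.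
Context {R : realType} {disp : measure_display} {Omega : measurableType disp}.
Context {E : normedModType R}.

Definition caratheodory (r : E -> Omega -> R) :=
  (forall w, continuous (r ^~ w : E -> R^o)) /\
  (forall y, measurable_fun setT (r y)).

Lemma caratheodoryD (r s : E -> Omega -> R) :
  caratheodory r -> caratheodory s ->
  caratheodory (fun y w => r y w + s y w).
Proof.
move=> [cr mr] [cs ms]; split.
  by move=> w y; apply: cvgD; [exact: cr|exact: cs].
by move=> y; exact: measurable_funD.
Qed.

Lemma caratheodory_dist (phi : E -> R) (m : Omega -> R) :
  continuous (phi : E -> R^o) -> measurable_fun setT m ->
  caratheodory (fun y w => `|phi y - m w|).
Proof.
move=> cphi mm; split.
  move=> w y; apply: cvg_norm; apply: cvgB; first exact: cphi.
  exact: cvg_cst.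
move=> y; apply: measurableT_comp => //.
by apply: measurable_funB => //; exact: measurable_cst.
Qed.

(** On a compact set a nonnegative continuous function vanishes somewhere iff its infimum is 0, and
    the infimum is already seen on the countable union of the finite nets. This leaves countable
    operations on events about single points. *)
Lemma measurable_exists_zero_compact (K : set E) (r : E -> Omega -> R) :
  compact K -> caratheodory r -> (forall y w, 0 <= r y w) ->
  measurable [set w | exists2 y, K y & r y w = 0].
Proof.
move=> cK [cr mr] r0.
have npos (n : nat) : (0:R) < n.+1%:R^-1 by [].
have [F HF] := choice (fun n => compact_finite_net (npos n) cK).
suff -> : [set w | exists2 y, K y & r y w = 0] =
    \bigcap_n \bigcup_m \bigcup_(q in F m)
      [set w | r q w < n.+1%:R^-1].
  apply: bigcap_measurable => // n _; apply: bigcup_measurable => m _.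
  apply: fin_bigcup_measurable; first by have [] := HF m.
  move=> q _; rewrite -[X in measurable X]setTI.
  have mlt : measurable_fun setT (fun w => r q w < n.+1%:R^-1).
    by apply: measurable_fun_ltr => //; exact: measurable_cst.
  exact: (mlt measurableT [set true]).
apply/seteqP; split => w.
  move=> [y Ky ry0] n _.
  have /(_ _ (nbhsx_ballx _ _ (npos n))) := cr w y.
  move=> /nbhs_ballP[d /= d0 dP].
  have [m md] : exists m : nat, m.+1%:R^-1 < d.
    by have [//|m] := @ltr_add_invr R 0 d _; rewrite add0r => ?; exists m.
  have [_ _ /(_ _ Ky)[q qF yq]] := HF m.
  exists m => //; exists q => //=.
  have := dP q (le_ball (ltW md) yq).
  by rewrite /= ry0 -ball_normE /= sub0r normrN ger0_norm.
move=> H.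
have [m0 _ [q0 q0F _]] := H 0 I.
have K0 : K !=set0 by exists q0; by have [_ FK _] := HF m0; exact: FK.
have := @compact_EVT_min E R (r ^~ w) K K0 cK.
case; first by apply: continuous_subspaceT; exact: cr.
move=> c /set_mem Kc cmin; exists c => //.
apply/eqP; rewrite eq_le r0 andbT leNgt; apply/negP => rc.
have [n nr] : exists n : nat, n.+1%:R^-1 < r c w.
  by have [//|n] := @ltr_add_invr R 0 (r c w) _; rewrite add0r => ?; exists n.
have [m _ [q qF /= rq]] := H n I.
have : r c w <= r q w by apply: cmin; apply: mem_set; have [_ FK _] := HF m; exact: FK.
by move/(lt_le_trans nr)/(lt_trans rq); rewrite ltxx.
Qed.

Hypothesis properE : proper_space E.

Lemma proper_compactI (L : set E) (N : R) : closed L ->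
  compact (L `&` [set y | `|y| <= N]).
Proof.
move=> cL; apply: (@subclosed_compact _ _ [set y | `|y| <= N]) => //.
  by apply: closedI => //; exact: closed_norm_le.
Qed.

Lemma measurable_exists_zero (L : set E) (r : E -> Omega -> R) :
  closed L -> caratheodory r -> (forall y w, 0 <= r y w) ->
  measurable [set w | exists2 y, L y & r y w = 0].
Proof.
move=> cL cr r0.
suff -> : [set w | exists2 y, L y & r y w = 0] =
    \bigcup_(n : nat)
      [set w | exists2 y, (L `&` [set y | `|y| <= n%:R]) y & r y w = 0].
  apply: bigcup_measurable => n _; apply: measurable_exists_zero_compact => //.
  exact: proper_compactI.
apply/seteqP; split => w.
  move=> [y Ly ry]; exists (Num.truncn `|y|).+1 => //; exists y => //; split => //=.
  by rewrite ltW// truncnS_gt.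
by move=> [n _ [y [Ly _] ry]]; exists y.
Qed.

(** Because the minimum is attained, [m w <= c] holds iff there is a zero in the closed set where
    moreover [phi y <= c], which is an event by the previous lemma. *)
Lemma measurable_argmin_value (L : set E) (r : E -> Omega -> R) (phi : E -> R)
    (m : Omega -> R) :
  closed L -> caratheodory r -> (forall y w, 0 <= r y w) ->
  continuous (phi : E -> R^o) ->
  (forall w, exists2 y, L y /\ r y w = 0 & phi y = m w) ->
  (forall w y, L y -> r y w = 0 -> m w <= phi y) ->
  measurable_fun setT m.
Proof.
move=> cL cr r0 cphi mex mmin.
apply: (measurability _ (RGenOInfty.measurableE R)).
move=> _ [_ [c ->] <-]; rewrite setTI.
have -> : m @^-1` `]c, +oo[%classic =
    ~` [set w | exists2 y, (L `&` [set y | phi y <= c]) y & r y w = 0].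
  apply/seteqP; split => w /=; rewrite in_itv /= andbT.
    move=> cm [y [Ly yc] ry]; have := mmin _ _ Ly ry.
    by rewrite leNgt => /negP; apply; exact: le_lt_trans yc cm.
  move=> H; rewrite ltNge; apply/negP => mc; apply: H.
  by have [y [Ly ry] ym] := mex w; exists y => //; split => //=; rewrite ym.
apply: measurableC; apply: measurable_exists_zero => //.
apply: closedI => //.
apply: (@preimage_closed E R^o phi [set z : R | z <= c]).
  by move=> y _; exact: cphi.
exact: closed_le.
Qed.

(* Minimizing the norm first makes the remaining solution sets compact, so
   that the minima of the functions [phi j], taken one after the other, are
   attained. *)
Lemma measurable_selection (L : set E) (r : E -> Omega -> R) (p : nat)
    (phi : nat -> E -> R) :
  closed L -> caratheodory r -> (forall y w, 0 <= r y w) ->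
  (forall j, continuous (phi j : E -> R^o)) ->
  (forall w, exists2 y, L y & r y w = 0) ->
  exists m : nat -> Omega -> R,
    (forall j, measurable_fun setT (m j)) /\
    forall w, exists2 y, L y /\ r y w = 0 & forall j, (j < p)%N -> phi j y = m j w.
Proof.
move=> cL cr r0 cphi rex.
have attain (s : E -> Omega -> R) (f : E -> R) : caratheodory s ->
    (forall y w, 0 <= s y w) -> continuous (f : E -> R^o) ->
    (forall w, exists2 y, L y & s y w = 0) ->
    (forall w, exists N, forall y, L y -> s y w = 0 ->
       exists2 y', L y' /\ s y' w = 0 & `|y'| <= N /\ f y' <= f y) ->
    exists m, [/\ measurable_fun setT m,
      forall w, exists2 y, L y /\ s y w = 0 & f y = m w &
      forall w y, L y -> s y w = 0 -> m w <= f y].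
  move=> cs s0 cf sex sN.
  suff /choice[m Hm] : forall w, exists m, (exists2 y, L y /\ s y w = 0 & f y = m)
      /\ forall y, L y -> s y w = 0 -> m <= f y.
    exists m; split; [|by move=> w; exact: (Hm w).1|by move=> w; exact: (Hm w).2].
    apply: (measurable_argmin_value cL cs s0 cf).
      by move=> w; exact: (Hm w).1.
    by move=> w; exact: (Hm w).2.
  move=> w; have [N HN] := sN w.
  pose K := (L `&` [set y | `|y| <= N]) `&` [set y | s y w = 0].
  have cK : compact K.
    apply: compact_closedI; first exact: proper_compactI.
    apply: (@preimage_closed E R^o (s ^~ w) [set 0]); last exact: closed_eq.
    by move=> y _; exact: cs.1.
  have K0 : K !=set0.
    have [y Ly sy] := sex w; have [y' [Ly' sy'] [y'N _]] := HN y Ly sy.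
    by exists y'.
  have [|c] := compact_EVT_min K0 cK (f := f); first exact: continuous_subspaceT.
  move=> /set_mem[[Lc cN] sc] cmin; exists (f c); split; first by exists c.
  move=> y Ly sy; have [y' [Ly' sy'] [y'N fy']] := HN y Ly sy.
  by apply: le_trans fy'; apply: cmin; exact: mem_set.
have refine_zero (s : E -> Omega -> R) (f : E -> R) (m : Omega -> R) y w :
    (forall y w, 0 <= s y w) ->
    (s y w + `|f y - m w| = 0) <-> (s y w = 0 /\ f y = m w).
  move=> s0; split; last by move=> [-> ->]; rewrite subrr normr0 addr0.
  move=> /eqP; rewrite paddr_eq0// normr_eq0 subr_eq0 => /andP[/eqP-> /eqP->].
  by [].
have [N [mN Nex _]] : exists m, [/\ measurable_fun setT m,
      forall w, exists2 y, L y /\ r y w = 0 & `|y| = m w &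
      forall w y, L y -> r y w = 0 -> m w <= `|y|].
  apply: attain => //; first exact: norm_continuous.
  move=> w; have [y0 Ly0 ry0] := rex w; exists `|y0| => y Ly ry.
  by have [yy0|/ltW yy0] := lerP `|y| `|y0|; [exists y|exists y0].
(* The induction carries the constraints found so far inside a single Carathéodory function [s]:
   fixing one more value adds the penalty [|phi p y - mp w|], so its zeros are successive minimizers
   of norm [N w]. *)
suff [m [mm [s [cs s0 sex sP]]]] : exists m : nat -> Omega -> R,
    (forall j, measurable_fun setT (m j)) /\
    exists s : E -> Omega -> R, [/\ caratheodory s, forall y w, 0 <= s y w,
      forall w, exists2 y, L y & s y w = 0 &
      forall y w, s y w = 0 -> [/\ r y w = 0, `|y| = N w &
        forall j, (j < p)%N -> phi j y = m j w]].
  exists m; split => // w; have [y Ly sy] := sex w.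
  by exists y; have [] := sP y w sy.
elim: p => [|p [m [mm [s [cs s0 sex sP]]]]].
  exists (fun=> cst 0); split; first by move=> j; exact: measurable_cst.
  exists (fun y w => r y w + `|(`|y|) - N w|); split.
  - apply: caratheodoryD => //; apply: (@caratheodory_dist (fun y => `|y|)) => //.
    exact: norm_continuous.
  - by move=> y w; rewrite addr_ge0.
  - move=> w; have [y [Ly ry] yN] := Nex w; exists y => //.
    exact/(refine_zero _ (fun y => `|y|)).
  - by move=> y w /(refine_zero _ (fun y => `|y|))[].
(* Every zero of [s] has norm [N w], so each competitor [y] is its own witness in the ball required
   by [attain]. *)
have [mp [mmp mpex _]] := attain s (phi p) cs s0 (cphi p) sex (fun w =>
  ex_intro _ (N w) (fun y Ly sy => ex_intro2 _ _ y (conj Ly sy)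
    (conj (eq_ind_r (fun z => z <= N w) (lexx _) (let: And3 _ e _ := sP y w sy in e))
      (lexx _)))).
exists (fun j => if j == p then mp else m j); split.
  by move=> j; case: ifP.
exists (fun y w => s y w + `|phi p y - mp w|); split.
- by apply: caratheodoryD => //; exact: caratheodory_dist.
- by move=> y w; rewrite addr_ge0.
- by move=> w; have [y [Ly sy] yp] := mpex w; exists y => //; exact/refine_zero.
- move=> y w /refine_zero[]// sy yp; have [ry yN ym] := sP y w sy; split => // j.
  by rewrite ltnS leq_eqVlt; case: eqP => [->//|_ /= /ym].
Qed.
End random_zero_sets.

(** * Convex cones and Farkas' lemma *)

Section dot_product.
Context {R : realType} {n : nat}.
Implicit Types (x y z : 'rV[R]_n) (a : R).

Lemma dotpC x y : dotp x y = dotp y x.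
Proof. by apply: eq_bigr => i _; rewrite mulrC. Qed.

Lemma dotpDl x y z : dotp (x + y) z = dotp x z + dotp y z.
Proof. by rewrite -big_split; apply: eq_bigr => i _; rewrite mxE mulrDl. Qed.

Lemma dotpZl a x y : dotp (a *: x) y = a * dotp x y.
Proof. by rewrite mulr_sumr; apply: eq_bigr => i _; rewrite mxE mulrA. Qed.

Lemma dotpNl x y : dotp (- x) y = - dotp x y.
Proof. by rewrite -scaleN1r dotpZl mulN1r. Qed.

Lemma dotpBl x y z : dotp (x - y) z = dotp x z - dotp y z.
Proof. by rewrite dotpDl dotpNl. Qed.

Lemma dotpDr x y z : dotp z (x + y) = dotp z x + dotp z y.
Proof. by rewrite dotpC dotpDl !(dotpC z). Qed.

Lemma dotpZr a x y : dotp y (a *: x) = a * dotp y x.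
Proof. by rewrite dotpC dotpZl dotpC. Qed.

Lemma dotpBr x y z : dotp z (x - y) = dotp z x - dotp z y.
Proof. by rewrite dotpC dotpBl !(dotpC z). Qed.

Lemma dotp_basis_vec (i : 'I_n) x : dotp (basis_vec i) x = x 0 i.
Proof.
rewrite /dotp (bigD1 i) //= /basis_vec mxE !eqxx mul1r big1 ?addr0 // => j ji.
by rewrite mxE eqxx (negbTE ji) mul0r.
Qed.

Lemma dotp_gt0 x : x != 0 -> 0 < dotp x x.
Proof.
move=> x0; rewrite lt_neqAle eq_sym sumr_ge0 ?andbT; last first.
  by move=> i _; rewrite -expr2 sqr_ge0.
apply: contra x0; rewrite psumr_eq0; last first.
  by move=> i _; rewrite -expr2 sqr_ge0.
move=> /allP x0; apply/eqP/rowP => i; rewrite mxE; apply/eqP.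
by have := x0 i (mem_index_enum i); rewrite /= mulf_eq0 orbb.
Qed.

Lemma dotp_ge0 x y : orthant x -> orthant y -> 0 <= dotp x y.
Proof. by move=> x0 y0; apply: sumr_ge0 => i _; rewrite mulr_ge0. Qed.

Lemma continuous_dotpl y : continuous (fun x => dotp x y : R^o).
Proof.
rewrite /dotp; apply: (@continuous_big R^o _ +%R 0 xpredT).
  exact: (@add_continuous R^o).
move=> i _ x; apply: (@cvgMl R _ (nbhs x) _ (fun z : 'rV[R]_n => z 0 i)).
exact: (@coord_continuous R 1 n 0 i x).
Qed.

(* Bartl's induction: a point [x0] violating the conclusion for the first [m]
   forms lies strictly on the wrong side of the last one, and projecting along
   [x0] onto the kernel of the last form removes that form. *)
Lemma farkas (m : nat) (A : nat -> 'rV[R]_n) y :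
  (forall x, (forall i, (i < m)%N -> 0 <= dotp (A i) x) -> 0 <= dotp y x) ->
  exists c : nat -> R, (forall i, 0 <= c i) /\ y = \sum_(i < m) c i *: A i.
Proof.
elim: m A y => [|m IH] A y H.
  exists (fun=> 0); split => //; rewrite big_ord0; apply/eqP; apply/negPn/negP => y0.
  by have := H (- y) (fun _ => ltac:(done)); rewrite dotpC dotpNl oppr_ge0 leNgt dotp_gt0.
have [|/existsNP[x0 /not_implyP[Ax0 /negP]]] := pselect (forall x,
    (forall i, (i < m)%N -> 0 <= dotp (A i) x) -> 0 <= dotp y x).
  move=> /IH[c [c0 ->]]; exists (fun i => if (i < m)%N then c i else 0); split.
    by move=> i; case: ifP.
  rewrite big_ord_recr /= ltnn scale0r addr0.
  by apply: eq_bigr => i _; rewrite ltn_ord.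
rewrite -ltNge => yx0.
have Am0 : dotp (A m) x0 < 0.
  rewrite ltNge; apply/negP => Am; move: yx0; rewrite ltNge => /negP; apply.
  by apply: H => i; rewrite ltnS leq_eqVlt => /predU1P[->//|/Ax0].
set a := dotp (A m) x0 in Am0.
have [x|c [c0 cE]] := IH (fun i => A i - (dotp (A i) x0 / a) *: A m)
    (y - (dotp y x0 / a) *: A m).
  move=> Ax.
  have projE z : dotp (z - (dotp z x0 / a) *: A m) x =
      dotp z (x - (dotp (A m) x / a) *: x0).
    rewrite dotpBl dotpZl dotpBr dotpZr; congr (_ - _).
    by rewrite mulrAC [RHS]mulrAC; congr (_ / _); exact: mulrC.
  rewrite projE; apply: H => i; rewrite ltnS leq_eqVlt => /predU1P[->|im].
    by rewrite dotpBr dotpZr -/a divfK ?subrr// lt_eqF.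
  by rewrite -projE Ax.
(* The last coefficient collects the multiples of [A m] split off by the projection. It is
   nonnegative: [dotp y x0] and [a] are negative, while [dotp (A i) x0] is nonnegative for the
   earlier forms. *)
exists (fun i => if (i < m)%N then c i
  else dotp y x0 / a - \sum_(i < m) c i * (dotp (A i) x0 / a)); split.
  move=> i; case: ifP => // _; rewrite addr_ge0//.
    by rewrite ltW// ltr_ndivlMr// mul0r.
  rewrite -sumrN sumr_ge0// => j _; rewrite -mulrN mulr_ge0// -mulrN.
  by rewrite mulr_ge0 ?Ax0 ?ltn_ord// oppr_ge0 invr_le0 ltW.
rewrite big_ord_recr /= ltnn.
under eq_bigr do rewrite ltn_ord.
rewrite -[LHS](subrK ((dotp y x0 / a) *: A m)) cE /=.
under eq_bigr do rewrite scalerBr scalerA.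
by rewrite sumrB -scaler_suml scalerBl addrAC addrA.
Qed.
End dot_product.

Section solvency_cones.
Context {R : realType} {D : nat}.
Implicit Types (Pi : 'M[R]_D) (v w : 'rV[R]_D).

Lemma smallest_convex_cone (A : set 'rV[R]_D) :
  convex_cone (smallest convex_cone A).
Proof.
move=> a b x y a0 b0 Ax Ay C CA.
by apply: CA.1 => //; [exact: Ax CA|exact: Ay CA].
Qed.

Lemma solvency_cone_convex Pi : convex_cone (solvency_cone Pi).
Proof. exact: smallest_convex_cone. Qed.

Lemma solvency_cone_basis Pi i : solvency_cone Pi (basis_vec i).
Proof. by apply: sub_gen_smallest; left; exists i. Qed.

Lemma solvency_cone_exchange Pi i j :
  solvency_cone Pi (Pi i j *: basis_vec i - basis_vec j).
Proof. by apply: sub_gen_smallest; right; exists i, j. Qed.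

Hypothesis D_gt0 : (0 < D)%N.

Lemma solvency_coneZ Pi a v :
  0 <= a -> solvency_cone Pi v -> solvency_cone Pi (a *: v).
Proof.
move=> a0 Kv; have := @solvency_cone_convex Pi a 0 v v a0 (lexx 0) Kv Kv.
by rewrite scale0r addr0.
Qed.

Lemma solvency_coneD Pi v w :
  solvency_cone Pi v -> solvency_cone Pi w -> solvency_cone Pi (v + w).
Proof.
move=> Kv Kw; have := @solvency_cone_convex Pi 1 1 v w ler01 ler01 Kv Kw.
by rewrite !scale1r.
Qed.

Lemma solvency_cone0 Pi : solvency_cone Pi 0.
Proof.
rewrite -(scale0r (basis_vec (Ordinal D_gt0))); apply: solvency_coneZ => //.
exact: solvency_cone_basis.
Qed.

Lemma solvency_cone_sum Pi (I : Type) (s : seq I) (F : I -> 'rV[R]_D) :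
  (forall i, solvency_cone Pi (F i)) -> solvency_cone Pi (\sum_(i <- s) F i).
Proof.
move=> KF; apply: big_ind => //; first exact: solvency_cone0.
exact: solvency_coneD.
Qed.

Lemma orthant_solvency_cone Pi v : orthant v -> solvency_cone Pi v.
Proof.
move=> v0; rewrite (row_sum_delta v); apply: solvency_cone_sum => i.
by apply: solvency_coneZ => //; exact: solvency_cone_basis.
Qed.

(* [mu i j] is the number of units of asset [j] bought with asset [i]. *)
Lemma solvency_coneP Pi v :
  solvency_cone Pi v <->
  exists mu : 'I_D -> 'I_D -> R, (forall i j, 0 <= mu i j) /\
    forall k, 0 <= v 0 k - \sum_j mu k j * Pi k j + \sum_i mu i k.
Proof.
split.
  apply: (smallest_sub _ _ (C := convex_cone)
    (X := [set v | exists mu : 'I_D -> 'I_D -> R, (forall i j, 0 <= mu i j) /\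
    forall k, 0 <= v 0 k - \sum_j mu k j * Pi k j + \sum_i mu i k])).
    move=> a b x y a0 b0 [mx [mx0 Hx]] [my [my0 Hy]].
    exists (fun i j => a * mx i j + b * my i j); split.
      by move=> i j; rewrite addr_ge0// mulr_ge0.
    move=> k; have := addr_ge0 (mulr_ge0 a0 (Hx k)) (mulr_ge0 b0 (Hy k)).
    have -> : \sum_j (a * mx k j + b * my k j) * Pi k j =
        a * (\sum_j mx k j * Pi k j) + b * (\sum_j my k j * Pi k j).
      by rewrite !mulr_sumr -big_split; apply: eq_bigr => j _; rewrite mulrDl !mulrA.
    by rewrite !mxE big_split /= -!mulr_sumr; lra.
  move=> _ [[i ->]|[i [j ->]]].
    exists (fun _ _ => 0); split => // k.
    rewrite !big1 ?subr0 ?addr0 /basis_vec ?mxE //.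
    by move=> j _; rewrite mul0r.
  exists (fun i' j' => ((i' == i) && (j' == j))%:R); split => // k.
  rewrite /basis_vec !mxE /=.
  have -> : \sum_(j0 < D) ((k == i) && (j0 == j))%:R * Pi k j0 =
      (k == i)%:R * Pi i j :> R.
    rewrite (bigD1 j) //= eqxx andbT big1 ?addr0.
      by case: eqP => [->//|]; rewrite !mul0r.
    by move=> l /negbTE->; rewrite andbF mul0r.
  have -> : \sum_(i0 < D) ((i0 == i) && (k == j))%:R = (k == j)%:R :> R.
    rewrite (bigD1 i) //= eqxx big1 ?addr0 //.
    by move=> l /negbTE->.
  by lra.
move=> [mu [mu0 Hk]].
set s := \row_k (v 0 k - \sum_j mu k j * Pi k j + \sum_i mu i k).
have -> : v = s + \sum_i \sum_j mu i j *: (Pi i j *: basis_vec i - basis_vec j).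
  apply/rowP => k; rewrite !mxE.
  have -> : (\sum_i \sum_j mu i j *: (Pi i j *: basis_vec i - basis_vec j)) 0 k
      = \sum_j mu k j * Pi k j - \sum_i mu i k.
    rewrite summxE.
    under eq_bigr => i _ do (rewrite summxE; under eq_bigr => j _ do
      rewrite !mxE /= mulrBr mulrA).
    under eq_bigr => i _ do rewrite sumrB -mulr_suml.
    rewrite sumrB (bigD1 k) //= eqxx mulr1 [X in _ + X - _]big1 ?addr0; last first.
      by move=> i /negbTE ik; rewrite eq_sym ik mulr0.
    congr (_ - _); apply: eq_bigr => i _.
    rewrite (bigD1 k) //= eqxx mulr1 big1 ?addr0// => j /negbTE jk.
    by rewrite eq_sym jk mulr0.
  lra.
apply: solvency_coneD.
  by apply: orthant_solvency_cone => k; rewrite mxE.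
apply: solvency_cone_sum => i; apply: solvency_cone_sum => j.
by apply: solvency_coneZ => //; exact: solvency_cone_exchange.
Qed.

Lemma solvency_dualP Pi w :
  solvency_dual Pi w <->
  orthant w /\ forall i j, 0 <= Pi i j * w 0 i - w 0 j.
Proof.
split.
  move=> Hw; split => [i|i j].
    by have := Hw _ (@solvency_cone_basis Pi i); rewrite dotp_basis_vec.
  have := Hw _ (@solvency_cone_exchange Pi i j).
  by rewrite dotpBl dotpZl !dotp_basis_vec.
move=> [w0 Hw]; apply: smallest_sub.
  move=> a b x y a0 b0 /= xw yw.
  by rewrite dotpDl !dotpZl addr_ge0// mulr_ge0.
move=> _ [[i ->]|[i [j ->]]] /=; first by rewrite dotp_basis_vec.
by rewrite dotpBl dotpZl !dotp_basis_vec.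
Qed.

(** The cone is generated by a finite list, so Farkas' lemma yields membership in the cone itself
    and not merely in its closure. *)
Lemma solvency_bipolar Pi v :
  (forall w, solvency_dual Pi w -> 0 <= dotp v w) -> solvency_cone Pi v.
Proof.
move=> Hv.
pose gens := [seq basis_vec i | i : 'I_D] ++
  [seq Pi p.1 p.2 *: basis_vec p.1 - basis_vec p.2 | p : 'I_D * 'I_D].
have Kgens i : solvency_cone Pi (nth 0 gens i).
  have [ig|ig] := ltnP i (size gens); last first.
    rewrite nth_default//; exact: solvency_cone0.
  have := mem_nth 0 ig; rewrite mem_cat => /orP[|] /mapP[k _ ->].
    exact: solvency_cone_basis.
  exact: solvency_cone_exchange.
have [x Hx|c [c0 ->]] := @farkas R D (size gens) (nth 0 gens) v.
  apply: Hv; apply/solvency_dualP.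
  have Hg g : g \in gens -> 0 <= dotp g x.
    by move=> gg; rewrite -(nth_index 0 gg); apply: Hx; rewrite index_mem.
  split => [i|i j].
    rewrite -dotp_basis_vec; apply: Hg; rewrite mem_cat.
    by apply/orP; left; apply/mapP; exists i => //; rewrite mem_enum.
  rewrite -!dotp_basis_vec -dotpZl -dotpBl; apply: Hg; rewrite mem_cat.
  by apply/orP; right; apply/mapP; exists (i, j) => //; rewrite mem_enum.
by apply: solvency_cone_sum => i; exact: solvency_coneZ.
Qed.

(** For small e > 0 the point [z - e *: g] is still in the dual cone, and pairing it with [g] gives
    dotp g z >= e * dotp g g > 0. *)
Lemma interior_dual_gt0 (K : set 'rV[R]_D) z g :
  interior (dual_cone K) z -> K g -> g != 0 -> 0 < dotp g z.
Proof.
move=> zK Kg g0.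
have cz : continuous (fun e : R^o => z - e *: g).
  move=> e; apply: cvgB; first exact: cvg_cst.
  by apply: cvgZl; exact: cvg_id.
have /(_ (dual_cone K)) := cz 0; rewrite /= scale0r subr0 => /(_ zK).
move=> /nbhs_ballP[e /= e0 eK].
have : ball (0 : R^o) e (e / 2).
  rewrite -ball_normE /= sub0r normrN gtr0_norm ?divr_gt0//.
  by rewrite ltr_pdivrMr// ltr_pMr// ltr1n.
move=> /eK /(_ _ Kg); rewrite dotpBr dotpZr subr_ge0; apply: lt_le_trans.
by rewrite mulr_gt0 ?dotp_gt0// divr_gt0.
Qed.

End solvency_cones.

Section closed_hulls.
Context {R : realType} {n : nat}.
Implicit Types (A B : set 'rV[R]_n) (x y w : 'rV[R]_n).

Lemma convex_setP A : @convex_set R 'rV[R]_n A <->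
  forall x y (t : R), A x -> A y -> 0 <= t <= 1 -> A (t *: x + (1 - t) *: y).
Proof.
split => [cA x y t Ax Ay /andP[t0 t1]|cA x y t /set_mem Ax /set_mem Ay].
  by have /set_mem := cA x y (Itv01 t0 t1) (mem_set Ax) (mem_set Ay).
apply: mem_set; apply: cA => //; apply/andP; split.
  exact: ge0.
exact: le1.
Qed.

Lemma smallest_convex_set A :
  @convex_set R 'rV[R]_n (smallest (@convex_set R 'rV[R]_n) A).
Proof.
apply/convex_setP => x y t Ax Ay t01 C CA.
by apply: (convex_setP C).1 CA.1 _ _ _ _ _ t01; [exact: Ax CA|exact: Ay CA].
Qed.

Lemma subset_closed_convex_hull A : A `<=` closed_convex_hull A.
Proof. by move=> x Ax; apply: subset_closure; exact: sub_gen_smallest. Qed.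

Lemma closed_closed_convex_hull A : closed (closed_convex_hull A).
Proof. exact: closed_closure. Qed.

Lemma closed_convex_hullS A B :
  A `<=` B -> closed_convex_hull A `<=` closed_convex_hull B.
Proof.
move=> sAB; apply: closureS; apply: sub_smallest2r => //.
exact: smallest_convex_set.
Qed.

Lemma closed_convex_hull_ge0 A w :
  A `<=` [set v | 0 <= dotp v w] -> closed_convex_hull A `<=` [set v | 0 <= dotp v w].
Proof.
move=> Aw.
have : closed [set v : 'rV[R]_n | 0 <= dotp v w].
  apply: (@preimage_closed 'rV[R]_n R^o (fun v => dotp v w) [set z : R | 0 <= z]).
    by move=> y _; exact: continuous_dotpl.
  exact: closed_ge.
move/closure_id => ->; apply: closureS; apply: smallest_sub => //.
apply/convex_setP => x y t /= xw yw /andP[t0 t1].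
by rewrite dotpDl !dotpZl addr_ge0// mulr_ge0// subr_ge0.
Qed.

(** A sum is twice a midpoint, and doubling preserves the hull of a set stable under nonnegative
    scaling. Continuity of addition carries this to the closure. *)
Lemma closed_convex_hullD A x y :
  (forall (a : R) z, 0 <= a -> A z -> A (a *: z)) ->
  closed_convex_hull A x -> closed_convex_hull A y ->
  closed_convex_hull A (x + y).
Proof.
move=> A2 Ax Ay.
set S := smallest (@convex_set R 'rV[R]_n) A.
have S2 z : S z -> S (2 *: z).
  suff : S `<=` [set z | S (2 *: z)] by apply.
  apply: smallest_sub => [|u Au]; last first.
    by apply: sub_gen_smallest; exact: A2.
  apply/convex_setP => u v t /= Su Sv t01.
  rewrite scalerDr !(scalerA 2) (mulrC 2) (mulrC 2) -!scalerA.
  exact: (convex_setP S).1 (@smallest_convex_set A) _ _ _ Su Sv t01.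
have SD u v : S u -> S v -> S (u + v).
  move=> Su Sv; have -> : u + v = 2 *: (2^-1 *: u + (1 - 2^-1) *: v).
    rewrite scalerDr !scalerA mulrBr mulfV// mulr1 scale1r.
    by rewrite -[X in X *: v]/(1 + 1 - 1) addrK scale1r.
  apply: S2; apply: (convex_setP S).1 (@smallest_convex_set A) _ _ _ Su Sv _.
  by rewrite invr_ge0 ler0n invf_le1// ler1n.
move=> B Bxy.
have /(_ B Bxy) := @add_continuous 'rV[R]_n (x, y).
case=> -[/= B1 B2] [B1x B2y] B12.
have [u [Su B1u]] := Ax _ B1x; have [v [Sv B2v]] := Ay _ B2y.
exists (u + v); split; first exact: SD.
exact: (B12 (u, v)).
Qed.

End closed_hulls.

(** * Left limits and predictability at the terminal time *)

Section left_limits.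
Context {R : realType}.

Lemma nondecreasing_cvg_at_left (f : R -> R) (a b : R) : a < b ->
  {in `[a, b] &, {homo f : x y / x <= y}} -> cvg (f x @[x --> b^'-]).
Proof.
move=> ab ndf.
have sub_ab (s x : R) : a < s -> x \in `]s, b[ -> x \in `[a, b].
  by move=> sa; rewrite !in_itv /= => /andP[sx xb]; rewrite !ltW// (lt_trans sa).
apply: nondecreasing_at_left_is_cvgr.
- near=> s => x y xs ys xy.
  have sa : a < s by near: s; exact: nbhs_left_gt.
  by apply: ndf => //; exact: sub_ab sa _.
- near=> s; exists (f b) => _ /= [x sx <-].
  have sa : a < s by near: s; exact: nbhs_left_gt.
  have := sub_ab s x sa sx; rewrite in_itv /= => /andP[ax xb].
  by apply: ndf => //; rewrite in_itv /= ?ax ?xb ?lexx ?ltW.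
Unshelve. all: by end_near. Qed.

(** By the Jordan decomposition [f] is on [a, b] a difference of nondecreasing functions, each of
    which has a left limit at [b]. *)
Lemma bounded_variation_cvg_at_left (f : R -> R) (a b : R) : a < b ->
  bounded_variation a b f -> cvg (f x @[x --> b^'-]).
Proof.
move=> ab bvf.
have bvNf := bounded_variationN bvf.
have fE := bounded_variation_pos_neg_tvE bvf.
have /cvg_ex[/= p fp] := nondecreasing_cvg_at_left ab (fine_neg_tv_nondecreasing bvNf).
have /cvg_ex[/= q fq] := nondecreasing_cvg_at_left ab (fine_neg_tv_nondecreasing bvf).
apply/cvg_ex; exists (p - q); apply: cvg_trans (cvgB fp fq).
apply: near_eq_cvg; near=> x.
suff xab : x \in `[a, b] by rewrite fE.
rewrite in_itv /=; apply/andP; split.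
  by rewrite ltW//; near: x; exact: nbhs_left_gt.
by near: x; exact: nbhs_left_le.
Unshelve. all: by end_near. Qed.

(** A sequence in [0, T) that starts at 0 and tends to T. Since it is countable, almost sure
    statements at each of its times hold simultaneously. *)
Definition approach (T : R) (k : nat) : R := T * (1 - k.+1%:R^-1).

Lemma approach_ge0 T k : 0 < T -> 0 <= approach T k.
Proof.
by move=> T0; rewrite mulr_ge0 ?(ltW T0)// subr_ge0 invf_le1// ler1n.
Qed.

Lemma approach_lt T k : 0 < T -> approach T k < T.
Proof.
by move=> T0; rewrite /approach gtr_pMr// gtrBl invr_gt0.
Qed.

Lemma approach_cvg T : 0 < T -> approach T k @[k --> \oo] --> T^'-.
Proof.
move=> T0.
have cT : approach T k @[k --> \oo] --> T.
  have -> : nbhs T = nbhs (T * (1 - 0)) by rewrite subr0 mulr1.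
  by apply: cvgMr; apply: cvgB; [exact: cvg_cst|exact: cvg_harmonic].
move=> B /cT TB.
have {}TB : \forall k \near \oo, approach T k < T -> B (approach T k) := TB.
suff : \forall k \near \oo, B (approach T k) by [].
by apply: filterS TB => k; apply; exact: approach_lt.
Qed.

Lemma cvg_mx (X : Type) (G : set_system X) {FG : Filter G} (m n : nat)
    (f : X -> 'M[R]_(m, n)) (l : 'M[R]_(m, n)) :
  (forall i j, f x i j @[x --> G] --> l i j) -> f x @[x --> G] --> l.
Proof.
move=> fl.
have -> : f = fun x => \sum_i \sum_j f x i j *: delta_mx i j.
  by apply/funext => x; exact: matrix_sum_delta.
rewrite [X in _ --> X](matrix_sum_delta l).
apply: (@cvg_big 'M[R]_(m, n) _ +%R 0 xpredT) => // [|i _].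
  exact: (@add_continuous 'M[R]_(m, n)).
apply: (@cvg_big 'M[R]_(m, n) _ +%R 0 xpredT) => // [|j _].
  exact: (@add_continuous 'M[R]_(m, n)).
by apply: cvgZl; exact: fl.
Qed.

Lemma cvg_mx_entry (X : Type) (G : set_system X) {FG : Filter G} (m n : nat)
    (f : X -> 'M[R]_(m, n)) (l : 'M[R]_(m, n)) i j :
  f x @[x --> G] --> l -> f x i j @[x --> G] --> l i j.
Proof.
move=> fl; apply: (cvg_comp f (fun M : 'M[R]_(m, n) => M i j)) fl _.
exact: coord_continuous.
Qed.

Context {disp : measure_display} {Omega : measurableType disp} {m n : nat}.
Variables (T : R) (T_gt0 : 0 < T) (X : R -> Omega -> 'M[R]_(m, n)) (w : Omega).

Lemma cvg_left_lim : cvg (X s w @[s --> T^'-]) ->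
  X s w @[s --> T^'-] --> left_lim X T w.
Proof. by rewrite /left_lim gt_eqF. Qed.

Lemma cvg_left_lim_BV : (forall i j, bounded_variation 0 T (fun t => X t w i j)) ->
  X s w @[s --> T^'-] --> left_lim X T w.
Proof.
move=> bv; apply: cvg_left_lim; apply/cvg_ex.
exists (\matrix_(i, j) lim (X s w i j @[s --> T^'-])).
apply: cvg_mx => i j; rewrite mxE.
exact: bounded_variation_cvg_at_left (bv i j).
Qed.

End left_limits.

Section sigma_algebra_closure.
Context {X : Type} (D : set X) (G : set (set X)).
Hypothesis sG : sigma_algebra D G.

Lemma sigma_algebraU A B : G A -> G B -> G (A `|` B).
Proof.
move=> GA GB; rewrite -bigcup2E; have [G0 _] := sG; apply => i.
by rewrite /bigcup2; case: ifP => // _; case: ifP.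
Qed.

Lemma sigma_algebraD A B : A `<=` D -> G A -> G B -> G (A `\` B).
Proof.
move=> sAD GA GB; have [_ GC _] := sG.
have -> : A `\` B = D `\` ((D `\` A) `|` B).
  apply/seteqP; split => x [].
    by move=> Ax nBx; split; [exact: sAD|case=> [[]|]].
  move=> Dx H; split; last by move=> Bx; apply: H; right.
  by apply: contrapT => nAx; apply: H; left.
by apply: (GC); apply: sigma_algebraU => //; exact: GC.
Qed.

Lemma sigma_algebra_bigcap_nat (A : (set X)^nat) :
  (forall k, A k `<=` D) -> (forall k, G (A k)) -> G (\bigcap_k A k).
Proof.
move=> sAD GA; have [_ GC GU] := sG.
have -> : \bigcap_k A k = D `\` \bigcup_k (D `\` A k).
  apply/seteqP; split => x.
    move=> Ax; split; first exact: (sAD 0%N _ (Ax 0%N I)).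
    by move=> [k _ [_]]; apply; exact: Ax.
  move=> [Dx H] k _; apply: contrapT => nAx; apply: H.
  by exists k.
by apply: (GC); apply: GU => k; exact: GC.
Qed.

End sigma_algebra_closure.

Section predictable_processes.
Context {R : realType} {disp : measure_display} {Omega : measurableType disp}.
Variables (T : R) (F : R -> set (set Omega)).
Hypotheses (T_gt0 : 0 < T) (filF : filtration T F).

Lemma filtration_sigma_algebra t : 0 <= t <= T -> sigma_algebra setT (F t).
Proof. by move=> tT; have [] := filF.1 t tT. Qed.

Lemma filtration_terminal : sigma_algebra setT (F T).
Proof. by apply: filtration_sigma_algebra; rewrite lexx ltW. Qed.

Lemma predictable_sets_sigma_algebra :
  sigma_algebra (`[0, T] `*` setT) (predictable_sets T F).
Proof. exact: smallest_sigma_algebra. Qed.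

(** [F T] serves as a common bound for the sections at all times; this suffices to make a limit of
    values of a predictable process F_T-measurable. *)
Lemma predictable_section A t : 0 <= t <= T ->
  predictable_sets T F A -> F T [set w | A (t, w)].
Proof.
move=> tT; have /andP[t0 tleT] := tT; have [F0 FC FU] := filtration_terminal.
have FtT B : F t B -> F T B by apply: filF.2.
move: A; apply: smallest_sub; first split => //=.
- move=> A FA; rewrite -[X in F T X](_ : setT `\` [set w | A (t, w)] = _).
    exact: FC.
  apply/seteqP; split => w /=; last by move=> [].
  by move=> [_ nA]; split => //; split => //=; rewrite in_itv /= t0.
- move=> A FA; rewrite -[X in F T X](_ : \bigcup_i [set w | A i (t, w)] = _).
    exact: FU.
  by apply/seteqP; split.
move=> _ [[B FB ->]|[s [u [B [s0 su uT FB ->]]]]] /=.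
  have [->|t_neq0] := eqVneq t 0.
    rewrite (_ : [set w | _] = B); last by apply/seteqP; split => w //= [].
    by apply: (filF.2 _ _ _ _ _ _ FB); rewrite ?lexx// ltW.
  rewrite (_ : [set w | _] = set0)//; apply/seteqP; split => w //= [/eqP].
  by rewrite (negbTE t_neq0).
have [tsu|tsu] := boolP (t \in `]s, u]).
  rewrite (_ : [set w | _] = B); last by apply/seteqP; split => w //= [].
  by apply: (filF.2 _ _ _ _ _ _ FB); rewrite ?lexx// (le_trans (ltW su)).
rewrite (_ : [set w | _] = set0)//; apply/seteqP; split => w //= [tsu' _].
by move/negP: tsu; apply.
Qed.

(** If C belongs to F_t with t < T, then {T} x C is the intersection of the generators ]s, T] x C
    over times s in [t, T) increasing towards T. The general case follows since such C generate
    F_{T-}. *)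
Lemma predictable_terminal B :
  F_left_T T F B -> predictable_sets T F ([set T] `*` B).
Proof.
have sP := predictable_sets_sigma_algebra; have [P0 PC PU] := sP.
have subD (C : set Omega) : [set T] `*` C `<=` `[0, T] `*` setT.
  by move=> [_ w] /= [-> _]; split => //=; rewrite in_itv /= lexx ltW.
have Pgen t C : 0 <= t < T -> F t C -> predictable_sets T F ([set T] `*` C).
  move=> /andP[t0 tT] FC.
  have -> : [set T] `*` C = \bigcap_k (`]Num.max t (approach T k), T] `*` C).
    apply/seteqP; split => -[s w] /=.
      move=> [-> Cw] k _; split => //=.
      by rewrite in_itv /= gt_max tT approach_lt// lexx.
    move=> H; have := H 0%N I => -[/= + Cw]; rewrite in_itv /= => /andP[_ sT].
    split => //; apply/eqP; rewrite eq_le sT /=.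
    rewrite leNgt; apply/negP => sltT.
    have : \forall k \near \oo, s < approach T k.
      exact: (approach_cvg T_gt0 (nbhs_left_gt sltT)).
    case=> k0 _ /(_ k0 (leqnn k0)) /= sk.
    have := H k0 I => -[/=]; rewrite in_itv /= gt_max => /andP[/andP[_ ks] _] _.
    by have := lt_trans sk ks; rewrite ltxx.
  apply: (sigma_algebra_bigcap_nat sP).
    move=> k [s w] /= [+ _]; rewrite !in_itv /= gt_max => /andP[/andP[ts _] ->].
    by rewrite (le_trans t0 (ltW ts)).
  move=> k; apply: sub_sigma_algebra; right.
  exists (Num.max t (approach T k)), T, C; split => //.
  - by rewrite le_max t0.
  - by rewrite gt_max tT approach_lt.
  - apply: (filF.2 _ _ _ _ _ _ FC) => //.
      by rewrite le_max lexx.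
    by rewrite ltW// gt_max tT approach_lt.
have F0T : F 0 setT.
  have [|F00 F0C _] := @filtration_sigma_algebra 0; first by rewrite lexx ltW.
  by have := F0C _ F00; rewrite setD0.
have PT : predictable_sets T F ([set T] `*` setT).
  by apply: (Pgen 0) => //; rewrite lexx.
move: B; apply: smallest_sub; first split => /=.
- by rewrite setX0.
- move=> A PA; rewrite (_ : _ `*` _ = ([set T] `*` setT) `\` ([set T] `*` A)).
    by apply: (sigma_algebraD sP) => //; exact: subD.
  apply/seteqP; split => -[s w] /=.
    by move=> [-> [_ nA]]; split => // -[].
  by move=> [[-> _] nA]; split => //; split => // Aw; apply: nA.
- move=> A PA; rewrite (_ : _ `*` _ = \bigcup_i ([set T] `*` A i)).
    exact: PU.
  apply/seteqP; split => -[s w] /=.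
    by move=> [-> [i _ Aw]]; exists i.
  by move=> [i _ [/= -> Aw]]; split => //; exists i.
move=> C [t /=]; rewrite in_itv /= => tT FC; exact: Pgen tT FC.
Qed.

Lemma predictable_measurable_terminal (D : nat) (V : R -> Omega -> 'rV[R]_D) t i :
  0 <= t <= T -> predictable T F V ->
  measurable_wrt setT (F T) (fun w => V t w 0 i).
Proof.
move=> tT pV B mB; have := predictable_section tT (pV 0 i B mB).
rewrite /measurable_wrt; congr (F T _); apply/seteqP; split => w /=.
  by move=> [].
by move=> [_ VB]; split => //; split => //=; rewrite in_itv.
Qed.

Hypothesis F_left : F_left_T T F = F T.

(** The scalar factor is the indicator of t >= T, so on [0, T] the new process is [V] before T and
    [Y] at T. Its preimages split along the predictable set {T} x Omega. *)
Lemma predictable_terminal_change (D : nat) (V : R -> Omega -> 'rV[R]_D)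
    (Y : Omega -> 'rV[R]_D) :
  predictable T F V -> (forall i, measurable_wrt setT (F T) (fun w => Y w 0 i)) ->
  predictable T F (fun t w => V t w + (T <= t)%R%:R *: (Y w - V T w)).
Proof.
move=> pV mY i0 i B mB.
have sP := predictable_sets_sigma_algebra.
have PT : predictable_sets T F ([set T] `*` setT).
  apply: predictable_terminal; rewrite F_left.
  have [F0 FC _] := filtration_terminal.
  by have := FC _ F0; rewrite setD0.
rewrite (_ : _ `&` _ =
  ((`[0, T] `*` setT) `&` (fun tw => V tw.1 tw.2 i0 i) @^-1` B) `\` ([set T] `*` setT)
  `|` [set T] `*` (setT `&` (fun w => Y w 0 i) @^-1` B)).
  apply: (sigma_algebraU sP).
    by apply: (sigma_algebraD sP) => //; exact: pV.
  by apply: predictable_terminal; rewrite F_left; exact: mY.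
apply/seteqP; split => -[t w] /=; rewrite !ord1.
  rewrite in_itv /= => -[[/andP[t0 tT] _]] .
  have [Tt|tltT] := lerP T t.
    have -> : t = T by apply/eqP; rewrite eq_le tT Tt.
    by rewrite scale1r addrC subrK => BY; right.
  rewrite scale0r addr0 => BV; left; split => //.
    by split => //; split => //; rewrite t0.
  by move=> [/eqP]; rewrite lt_eqF.
case=> [[[[+ _] BV] nT]|[-> [_ BY]]].
  rewrite in_itv /= => /andP[t0 tT]; split; first by rewrite ?in_itv /= t0 tT.
  have [Tt|tltT] := lerP T t; last by rewrite scale0r addr0.
  by case: nT; split => //; apply/eqP; rewrite eq_le tT Tt.
by split; rewrite ?in_itv /= ?lexx ?scale1r ?(addrC (V T w)) ?subrK// ltW.
Qed.

Lemma bounded_variation_terminal_change (f : R -> R) (c : R) :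
  bounded_variation 0 T f ->
  bounded_variation 0 T (fun t => f t + (T <= t)%R%:R * c).
Proof.
move=> bvf; have T0 := ltW T_gt0.
have step (a : R) : 0 <= a -> bounded_variation 0 T (fun t => (T <= t)%R%:R * a).
  move=> a0; apply: nondecreasing_bounded_variation => s t _ _ st.
  apply: ler_wpM2r => //; rewrite ler_nat.
  by have [Ts|//] := boolP (T <= s); rewrite (le_trans Ts st).
suff : bounded_variation 0 T (fun t => (T <= t)%R%:R * c).
  exact: (bounded_variationD T_gt0 bvf).
have [c0|/ltW c0] := lerP 0 c.
  exact: step.
have := bounded_variationN (step (- c) _).
rewrite oppr_ge0 => /(_ c0); congr bounded_variation; apply/funext => t /=.
by rewrite /= mulrN opprK.
Qed.

End predictable_processes.

(** * The jump at the terminal time *)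

Section solvency_limits.
Context {R : realType} {D : nat}.
Hypothesis D_gt0 : (0 < D)%N.
Implicit Types (Pi : 'M[R]_D) (v w : 'rV[R]_D).

Lemma opp_setP (K : set 'rV[R]_D) v : opp_set K v <-> K (- v).
Proof.
split; first by move=> [u Ku <-]; rewrite opprK.
by move=> Kv; exists (- v) => //; rewrite opprK.
Qed.

(** An exchange inequality that is an equality at [w] may fail for nearby matrices; the strict
    inequalities obtained here persist. The diagonal is excluded, since [Pi i i = 1] always gives 0
    there. *)
Lemma solvency_dual_perturb Pi w z (e : R) : bid_ask Pi -> 0 < e ->
  solvency_dual Pi w -> interior (solvency_dual Pi) z ->
  orthant (w + e *: z) /\
  forall i j, i != j -> 0 < Pi i j * (w + e *: z) 0 i - (w + e *: z) 0 j.
Proof.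
move=> baPi e0 wP zI.
have [w0 wex] := (solvency_dualP Pi w).1 wP.
have [z0 zex] := (solvency_dualP Pi z).1 (interior_subset zI).
split; first by move=> i; rewrite !mxE addr_ge0// mulr_ge0// ltW.
move=> i j ij.
suff zij : 0 < Pi i j * z 0 i - z 0 j.
  rewrite !mxE mulrDr opprD addrACA ltr_wpDl// mulrCA -mulrBr mulr_gt0//.
have -> : Pi i j * z 0 i - z 0 j = dotp (Pi i j *: basis_vec i - basis_vec j) z.
  by rewrite dotpBl dotpZl !dotp_basis_vec.
apply: (interior_dual_gt0 zI); first exact: solvency_cone_exchange.
apply/eqP => /rowP /(_ i); rewrite !mxE !eqxx /= (negbTE ij) subr0 mulr1.
by apply/eqP; rewrite gt_eqF//; have [] := baPi.
Qed.

Variables (T : R) (T_gt0 : 0 < T) (Pi : R -> 'M[R]_D).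
Hypotheses (Pi_bid_ask : forall t, 0 <= t <= T -> bid_ask (Pi t))
  (Pi_cvg : Pi s @[s --> T^'-] --> Pi T).

Lemma solvency_dual_near_left w :
  orthant w -> (forall i j, i != j -> 0 < Pi T i j * w 0 i - w 0 j) ->
  \forall s \near T^'-, solvency_dual (Pi s) w.
Proof.
move=> w0 wpos.
have H : \forall s \near T^'-, forall i j, 0 <= Pi s i j * w 0 i - w 0 j.
  apply: filter_forall => i; apply: filter_forall => j.
  (* The diagonal inequality is an equality for every bid-ask matrix and cannot come from strictness
     at T. *)
  have [->|ij] := eqVneq i j.
    near=> s; have [|_ -> _] := @Pi_bid_ask s; last by rewrite mul1r subrr.
    apply/andP; split; near: s; last exact: nbhs_left_le.
    exact: nbhs_left_ge.
  have cij : (Pi s i j * w 0 i - w 0 j) @[s --> T^'-] --> (Pi T i j * w 0 i - w 0 j).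
    apply: cvgB; last exact: cvg_cst.
    by apply: cvgMl; exact: cvg_mx_entry.
  near=> s; apply: ltW; near: s.
  exact: cvgr_gt cij _ (wpos _ _ ij).
by apply: filterS H => s Hs; apply/solvency_dualP.
Unshelve. all: by end_near. Qed.

(** The set of the self-financing condition in one fixed scenario, without the change of sign. The
    time interval is open at [t], so trades at time [t] itself are not included. *)
Definition trading_hull (s t : R) : set 'rV[R]_D :=
  closed_convex_hull (\bigcup_(u in `[s, t[) solvency_cone (Pi u) `|` [set 0]).

Lemma trading_hullS s t s' t' : s' <= s -> t <= t' ->
  trading_hull s t `<=` trading_hull s' t'.
Proof.
move=> ss tt; apply: closed_convex_hullS => v [[u /= su Ku]|]; last by right.
left; exists u => //=; move: su; rewrite !in_itv /= => /andP[su ut].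
by rewrite (le_trans ss su) (lt_le_trans ut tt).
Qed.

Lemma trading_hull0 s t : trading_hull s t 0.
Proof. by apply: subset_closed_convex_hull; right. Qed.

Lemma trading_hullD s t x y :
  trading_hull s t x -> trading_hull s t y -> trading_hull s t (x + y).
Proof.
apply: closed_convex_hullD => a z a0 [[u su Ku]|->].
  by left; exists u => //; exact: solvency_coneZ.
by right; rewrite scaler0.
Qed.

(** Carry out the exchanges [mu] of [v] at the prices of a time u < T, and compensate the change of
    cost by adding [c u]. The result [vs u] lies in K_u and tends to [v], because the prices tend to
    those at T. *)
Lemma solvency_cone_trading_hull s : 0 <= s < T ->
  solvency_cone (Pi T) `<=` trading_hull s T.
Proof.
move=> /andP[s0 sT] v /(solvency_coneP D_gt0)[mu [mu0 Hmu]].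
pose c u i := \sum_j mu i j * (Pi u i j - Pi T i j).
pose vs u := v + \row_k c u k.
have vsK u : solvency_cone (Pi u) (vs u).
  apply/(solvency_coneP D_gt0); exists mu; split => // k.
  apply: le_trans (Hmu k) _; rewrite le_eqVlt; apply/orP; left; apply/eqP.
  rewrite !mxE /c; under [X in _ = _ + X - _ + _]eq_bigr do rewrite mulrBr.
  by rewrite sumrB; lra.
have cvs : vs u @[u --> T^'-] --> v.
  have vT : v = v + \row_k c T k.
    apply/rowP => k; rewrite !mxE /c big1 ?addr0// => j _.
    by rewrite subrr mulr0.
  rewrite [X in _ --> X]vT; apply: cvgD; first exact: cvg_cst.
  apply: cvg_mx => i k; rewrite mxE; under eq_cvg do rewrite mxE.
  apply: (@cvg_big R^o _ +%R 0 xpredT) => // [|j _].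
    exact: (@add_continuous R^o).
  by apply: cvgMr; apply: cvgB; [exact: cvg_mx_entry|exact: cvg_cst].
move=> B Bv.
have near_s : \forall u \near T^'-, B (vs u) /\ s <= u < T.
  near=> u; split; first by near: u; exact: cvs.
  apply/andP; split; near: u; first exact: nbhs_left_ge.
  exact: nbhs_left_lt.
have [u [Bu su]] := @filter_ex _ _ (at_left_proper_filter T) _ near_s.
by exists (vs u); split => //; apply: sub_gen_smallest; left; exists u.
Unshelve. all: by end_near. Qed.

Lemma near_left_approach (Q : R -> Prop) : (\forall s \near T^'-, Q s) ->
  \forall k \near \oo, forall s, approach T k <= s < T -> Q s.
Proof.
move=> /nbhs_ballP[d /= d0 dP].
have Td : \forall s \near T^'-, T - d < s by apply: nbhs_left_gt; rewrite gtrBl.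
have {}Td : \forall k \near \oo, T - d < approach T k := approach_cvg T_gt0 Td.
apply: filterS Td => k Tdk s /andP[ks sT]; apply: dP => //.
by rewrite -ball_normE /= ger0_norm ?subr_ge0 ?ltW// ltrBlDr -ltrBlDl (lt_le_trans Tdk).
Qed.

(** For large k the vector [w + e *: z] belongs to K_s^* for all s in [approach T k, T), hence is
    nonnegative on the hull of the trades made there. Let k tend to infinity, then e to 0. *)
Lemma terminal_jump_solvent (z l : 'rV[R]_D) (V : R -> 'rV[R]_D) :
  interior (solvency_dual (Pi T)) z ->
  V s @[s --> T^'-] --> l ->
  (forall k, opp_set (trading_hull (approach T k) T) (V T - V (approach T k))) ->
  solvency_cone (Pi T) (l - V T).
Proof.
move=> zI Vl VT; apply: solvency_bipolar => // w wP.
have T01 : 0 <= T <= T by rewrite lexx ltW.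
have lk : V (approach T k) @[k --> \oo] --> l := cvg_comp _ _ (approach_cvg T_gt0) Vl.
have pos e : 0 < e -> 0 <= dotp (l - V T) (w + e *: z).
  move=> e0.
  have [we0 wepos] := solvency_dual_perturb (Pi_bid_ask T01) e0 wP zI.
  have ck : (dotp (V (approach T k) - V T) (w + e *: z) : R^o) @[k --> \oo]
      --> (dotp (l - V T) (w + e *: z) : R^o).
    apply: (cvg_comp (fun k => V (approach T k) - V T)
      (fun y => dotp y (w + e *: z) : R^o)); last exact: continuous_dotpl.
    by apply: cvgB => //; exact: cvg_cst.
  have : \forall k \near \oo, 0 <= dotp (V (approach T k) - V T) (w + e *: z).
    have near_dual := near_left_approach (solvency_dual_near_left we0 wepos).
    apply: filterS near_dual => k Hk.
    have /opp_setP := VT k; rewrite opprB.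
    apply: (@closed_convex_hull_ge0 R D _ (w + e *: z)) => v [[s /= ks Kv]|->].
      by apply: (Hk s _ _ Kv); rewrite in_itv /= in ks.
    by rewrite /= -(scale0r w) dotpZl mul0r.
  exact: cvgr_to_ge ck.
set b := dotp (l - V T) z.
(* Perturbing by e / (|b| + 1) changes the pairing by at most e; the added 1 keeps the denominator
   positive when b = 0. *)
have b1 : 0 < `|b| + 1 by rewrite ltr_wpDl.
apply/ler_addgt0Pr => e e0.
have := pos _ (divr_gt0 e0 b1); rewrite dotpDr dotpZr -/b => /le_trans; apply.
rewrite lerD2l -mulrA ger_pMr// mulrC ler_pdivrMr// mul1r.
by rewrite (le_trans (ler_norm b))// lerDl.
Qed.

End solvency_limits.

Section market_theory.
Context {R : realType} {disp : measure_display} {Omega : measurableType disp}.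
Variables (P : probability Omega R) (T : R) (F : R -> set (set Omega)).
Hypotheses (T_gt0 : 0 < T) (filF : filtration T F) (F_left : F_left_T T F = F T).

Lemma ae_forall_nat (Q : nat -> Omega -> Prop) :
  (forall k, {ae P, forall w, Q k w}) -> {ae P, forall w, forall k, Q k w}.
Proof.
move=> aeQ; have := negligible_bigcup aeQ; apply: negligibleS => w /=.
move=> /existsNP[k nQ]; by exists k.
Qed.

Lemma bounded_stopping_time_cst s : 0 <= s <= T -> bounded_stopping_time T F (fun=> s).
Proof.
move=> /andP[s0 sT]; split; first by move=> w; left; rewrite !lee_fin s0.
move=> t tT; have [F0 FC _] := filtration_sigma_algebra filF tT.
have FT := FC _ F0; rewrite setD0 in FT.
have [st|ts] := lerP s t.
  by have -> : [set w : Omega | ((EFin \o (fun=> s)) w <= t%:E)%E] = setT;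
    first by apply/seteqP; split => w //= _; rewrite lee_fin.
by have -> : [set w : Omega | ((EFin \o (fun=> s)) w <= t%:E)%E] = set0;
  first by apply/seteqP; split => w //=; rewrite lee_fin leNgt ts.
Qed.

Lemma bounded_stopping_timeP (tau : Omega -> R) : bounded_stopping_time T F tau ->
  forall w, 0 <= tau w <= T.
Proof. by move=> [tauT _] w; case: (tauT w) => //=; rewrite !lee_fin. Qed.

Lemma bounded_stopping_time_max (tau : Omega -> R) s :
  bounded_stopping_time T F tau -> 0 <= s <= T ->
  bounded_stopping_time T F (fun w => Num.max (tau w) s).
Proof.
move=> tauB /andP[s0 sT]; split.
  move=> w; have /andP[tau0 tauT] := bounded_stopping_timeP tauB w.
  by left; rewrite /= !lee_fin le_max tau0 ge_max tauT.
move=> t tT; have [F0 FC _] := filtration_sigma_algebra filF tT.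
have [st|ts] := lerP s t.
  have -> : [set w | ((EFin \o (fun w => Num.max (tau w) s)) w <= t%:E)%E] =
      [set w | ((tau w)%:E <= t%:E)%E].
    by apply/seteqP; split => w /=; rewrite !lee_fin ge_max st andbT.
  exact: tauB.2.
by have -> : [set w | ((EFin \o (fun w => Num.max (tau w) s)) w <= t%:E)%E] = set0;
  first by apply/seteqP; split => w //=; rewrite lee_fin ge_max andbC leNgt ts.
Qed.

Context {D : nat}.
Variable Pi : R -> Omega -> 'M[R]_D.
Hypotheses (D_gt0 : (0 < D)%N)
  (Pi_bid_ask : forall (t : R) w, 0 <= t <= T -> bid_ask (Pi t w))
  (Pi_cadlag : cadlag T Pi)
  (Pi_left : {ae P, forall w, left_lim Pi T w = Pi T w}).
Implicit Type V : R -> Omega -> 'rV[R]_D.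

Lemma ae_Pi_cvg : {ae P, forall w, Pi s w @[s --> T^'-] --> Pi T w}.
Proof.
apply: filterS Pi_left => w; rewrite /left_lim gt_eqF// => <-.
by apply: (Pi_cadlag w).2; rewrite lexx T_gt0.
Qed.

Lemma ae_cvg_left_lim V : self_financing P T F Pi V ->
  {ae P, forall w, V s w @[s --> T^'-] --> left_lim V T w}.
Proof.
move=> [_ bvV _]; apply: filterS bvV => w bvw.
by apply: cvg_left_lim_BV => // i j; rewrite ord1.
Qed.

Lemma preterminal_jump_solvent V : Zs P T F Pi !=set0 ->
  self_financing P T F Pi V ->
  {ae P, forall w, solvency_cone (Pi T w) (left_lim V T w - V T w)}.
Proof.
move=> [Z [_ Zint _]] sfV; have [_ _ sfV3] := sfV.
have TT : 0 <= T <= T by rewrite lexx ltW.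
have jumps : {ae P, forall w, forall k,
    opp_set (trading_hull (fun t => Pi t w) (approach T k) T)
      (V T w - V (approach T k) w)}.
  apply: ae_forall_nat => k; have kT := approach_lt k T_gt0.
  apply: (sfV3 (fun=> approach T k) (fun=> T)) => [||w]; last exact: ltW.
    by apply: bounded_stopping_time_cst; rewrite approach_ge0//= ltW.
  exact: bounded_stopping_time_cst.
have ZT := Zint _ (bounded_stopping_time_cst TT).
apply: filterS (filterI (filterI jumps ZT) (filterI ae_Pi_cvg (ae_cvg_left_lim sfV))).
move=> w [[Jw /(_ (ltry _)) Zw] [Pw Vw]].
exact: (terminal_jump_solvent D_gt0 T_gt0 (Pi := fun t => Pi t w)
  (fun t => @Pi_bid_ask t w) Pw Zw Vw Jw).
Qed.

(* Changing a portfolio at the terminal time only: the new jump at [T] is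
   financed by the trades available just before [T], since [K_T = K_{T-}]. *)
Lemma portfolio_terminal_change (x : 'rV[R]_D) V (Y : Omega -> 'rV[R]_D) :
  portfolios P T F Pi x V ->
  (forall i, measurable_wrt setT (F T) (fun w => Y w 0 i)) ->
  {ae P, forall w, orthant (Y w)} ->
  {ae P, forall w, solvency_cone (Pi T w) (left_lim V T w - Y w)} ->
  portfolios P T F Pi x (fun t w => V t w + (T <= t)%R%:R *: (Y w - V T w)).
Proof.
move=> [sfV [a a0 [_ admV]] V0] mY Y0 YK.
have [prV bvV sfV3] := sfV.
have TT : 0 <= T <= T by rewrite lexx ltW.
have VT w t : T <= t -> t <= T -> V t w + (T <= t)%R%:R *: (Y w - V T w) = Y w.
  move=> Tt tT; rewrite Tt scale1r; have -> : t = T by apply/eqP; rewrite eq_le tT.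
  by rewrite addrC subrK.
have Vt w t : t < T -> V t w + (T <= t)%R%:R *: (Y w - V T w) = V t w.
  by move=> tT; rewrite leNgt tT scale0r addr0.
split; first split.
- exact: predictable_terminal_change.
- apply: filterS bvV => w bvw i.
  have := bounded_variation_terminal_change T_gt0 (Y w 0 i - V T w 0 i) (bvw i).
  by congr bounded_variation; apply/funext => t; rewrite !mxE.
- move=> sigma tau sigmaB tauB st.
  (* Taking the maximum with [sigma] keeps the approximating stopping times after [sigma], as the
     self-financing condition demands. *)
  have jumps : {ae P, forall w, forall k,
      opp_set
        (trading_hull (fun t => Pi t w) (sigma w) (Num.max (sigma w) (approach T k)))
        (V (Num.max (sigma w) (approach T k)) w - V (sigma w) w)}.
    apply: ae_forall_nat => k; have kT := approach_lt k T_gt0.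
    apply: (sfV3 sigma (fun w => Num.max (sigma w) (approach T k))) => // [|w].
      by apply: bounded_stopping_time_max => //; rewrite approach_ge0//= ltW.
    by rewrite le_max lexx.
  have sfst := sfV3 _ _ sigmaB tauB st.
  apply: filterS (filterI (filterI jumps sfst)
    (filterI YK (filterI ae_Pi_cvg (ae_cvg_left_lim sfV)))) => w.
  move=> [[Jw Sw] [YKw [Pw Vw]]]; cbv beta.
  have /andP[s0 sT] := bounded_stopping_timeP sigmaB w.
  have /andP[t0 tT] := bounded_stopping_timeP tauB w.
  have [tltT|Tt] : (tau w < T) \/ (T <= tau w) by apply/orP; rewrite ltNge orNb.
    by have sltT := le_lt_trans (st w) tltT; rewrite !Vt.
  have tauT : tau w = T by apply/eqP; rewrite eq_le tT.
  rewrite VT// tauT; apply/opp_setP; rewrite opprB -/(trading_hull _ _ _).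
  have [Ts|sltT] : (T <= sigma w) \/ (sigma w < T) by apply/orP; rewrite ltNge orbN.
    by rewrite VT// subrr; exact: trading_hull0.
  (* V_sigma - Y is split into V_sigma - V_{T-}, a limit of elements of the closed hull, and V_{T-}
     - Y, an element of K_T. *)
  rewrite Vt// -(subrK (left_lim V T w) (V (sigma w) w)) -addrA.
  apply: trading_hullD => //; last first.
    have s0T : 0 <= sigma w < T by rewrite s0.
    exact: (solvency_cone_trading_hull D_gt0 (Pi := fun t => Pi t w) Pw s0T YKw).
  have cV : V (sigma w) w - V (approach T k) w @[k --> \oo] -->
      V (sigma w) w - left_lim V T w.
    apply: cvgB; first exact: cvg_cst.
    exact: (cvg_comp _ _ (approach_cvg T_gt0) Vw).
  suff near_hull : \forall k \near \oo,
      trading_hull (fun t => Pi t w) (sigma w) T (V (sigma w) w - V (approach T k) w).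
    exact: (@closed_cvg _ _ _ _ _ _ (@closed_closed_convex_hull _ _ _) near_hull _ cV).
  have near_s : \forall k \near \oo, sigma w < approach T k.
    exact: (approach_cvg T_gt0 (nbhs_left_gt sltT)).
  apply: filterS near_s => k sk.
  have /opp_setP := Jw k; rewrite opprB (max_idPr _); last exact: ltW.
  by apply: trading_hullS => //; rewrite ltW// approach_lt.
(* The constant of [V] still works: nothing changes before T, and at T both Y + a 1 and the price
   process are nonnegative. *)
- exists a => //; split.
    apply: filterS Y0 => w Y0w; rewrite VT//.
    by apply: orthant_solvency_cone => // i; rewrite !mxE addr_ge0// ltW.
  move=> tau Z tauB ZZ; have := admV _ _ tauB ZZ.
  move=> admVw; apply: filterS (filterI Y0 admVw) => w [Y0w Aw].
  have /andP[t0 tT] := bounded_stopping_timeP tauB w.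
  have [tltT|Tt] : (tau w < T) \/ (T <= tau w) by apply/orP; rewrite ltNge orNb.
    by rewrite Vt.
  rewrite VT//; apply: dotp_ge0; first by move=> i; rewrite !mxE addr_ge0// ltW.
  by have [[/(_ (tau w) w)]] := ZZ; rewrite t0 tT => /(_ isT)[].
- by apply: filterS V0 => w V0w; rewrite Vt.
Qed.

End market_theory.

(** * Measurable liquidation *)

Section caratheodory_closure.
Context {R : realType} {disp : measure_display} {Omega : measurableType disp}.
Context {E : normedModType R}.

Lemma caratheodory_cst (f : Omega -> R) :
  measurable_fun setT f -> caratheodory (fun (_ : E) => f).
Proof. by move=> mf; split => // w y; exact: cvg_cst. Qed.

Lemma caratheodory_cont (f : E -> R) :
  continuous (f : E -> R^o) -> caratheodory (fun y (_ : Omega) => f y).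
Proof. by move=> cf; split => // y; exact: measurable_cst. Qed.

Lemma caratheodoryM (r s : E -> Omega -> R) :
  caratheodory r -> caratheodory s ->
  caratheodory (fun y w => r y w * s y w).
Proof.
move=> [cr mr] [cs ms]; split.
  by move=> w y; apply: cvgM; [exact: cr|exact: cs].
by move=> y; exact: measurable_funM.
Qed.

Lemma caratheodory_sum (I : Type) (t : seq I) (r : I -> E -> Omega -> R) :
  (forall i, caratheodory (r i)) ->
  caratheodory (fun y w => \sum_(i <- t) r i y w).
Proof.
move=> cr; elim: t => [|i t IH].
  have -> : (fun y w => \sum_(i <- [::]) r i y w) = fun (_ : E) => cst 0.
    by apply/funext => y; apply/funext => w; rewrite big_nil.
  by apply: caratheodory_cst; exact: measurable_cst.
have -> : (fun y w => \sum_(j <- i :: t) r j y w) =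
    fun y w => r i y w + \sum_(j <- t) r j y w.
  by apply/funext => y; apply/funext => w; rewrite big_cons.
exact: caratheodoryD.
Qed.

Lemma caratheodory_norm (r : E -> Omega -> R) :
  caratheodory r -> caratheodory (fun y w => `|r y w|).
Proof.
move=> [cr mr]; split; first by move=> w y; apply: cvg_norm; exact: cr.
by move=> y; exact: measurableT_comp.
Qed.

End caratheodory_closure.

Section liquidation.
Context {R : realType} {disp : measure_display} {Omega : measurableType disp}.
Context {d D : nat}.
Hypothesis D_gt0 : (0 < D)%N.
Variables (U : 'rV[R]_d -> \bar R) (W : Omega -> 'rV[R]_D) (Pi : Omega -> 'M[R]_D).
Hypotheses (U_usc : upper_semicontinuous U)
  (mW : forall i, measurable_fun setT (fun w => W w 0 i))
  (mPi : forall i j, measurable_fun setT (fun w => Pi w i j)).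

Definition liquidations (w : Omega) : set 'rV[R]_d :=
  [set xi | orthant xi /\ opp_set (solvency_cone (Pi w)) (pad0 xi - W w)].

Definition optimal_liquidation (w : Omega) : \bar R :=
  ereal_sup [set U xi | xi in liquidations w].

(* A point is a triple of a liquidated position, the exchanges leading to it
   and a level below its utility. *)
Let E : normedModType R := ('rV[R]_d * 'rV[R]_(D * D) * R^o)%type.

(** The utility itself could not enter a Carathéodory function, as it need be neither continuous nor
    finite; its hypograph is closed by upper semicontinuity. *)
Let L : set E := [set y | [/\ orthant y.1.1, orthant y.1.2 & (y.2%:E <= U y.1.1)%E]].

Let mu (y : E) i j : R := y.1.2 0 (mxvec_index i j).

(** What remains of asset k after delivering the position, paying for the exchanges out of k and
    receiving those into k. *)
Let slack (k : 'I_D) (y : E) (w : Omega) : R :=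
  W w 0 k + - pad0 y.1.1 0 k + \sum_j mu y k j * - Pi w k j + \sum_i mu y i k.

(** Each summand is twice the negative part of a slack, so a system of inequalities becomes a single
    equation. *)
Let violation (y : E) w : R := \sum_k (`|slack k y w| + - slack k y w).

Let continuous_position : continuous (fun y : E => y.1.1).
Proof.
move=> y.
apply: (cvg_comp (fun y : E => y.1) (fun x : 'rV[R]_d * 'rV[R]_(D * D) => x.1)).
  exact: cvg_fst.
exact: cvg_fst.
Qed.

Let continuous_xi i : continuous (fun y : E => y.1.1 0 i : R^o).
Proof.
move=> y; apply: (cvg_comp (fun y : E => y.1.1) (fun x : 'rV[R]_d => x 0 i)).
  exact: continuous_position.
exact: coord_continuous.
Qed.

Let continuous_mu i : continuous (fun y : E => y.1.2 0 i : R^o).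
Proof.
move=> y; apply: (cvg_comp (fun y : E => y.1.2) (fun x : 'rV[R]_(D * D) => x 0 i)).
  apply: (cvg_comp (fun y : E => y.1) (fun x : 'rV[R]_d * 'rV[R]_(D * D) => x.2)).
    exact: cvg_fst.
  exact: cvg_snd.
exact: coord_continuous.
Qed.

Let continuous_level : continuous (fun y : E => y.2 : R^o).
Proof. by move=> y; exact: cvg_snd. Qed.

Let closed_L : closed L.
Proof.
have closed_orthant_L (p : nat) (f : E -> 'rV[R]_p) :
    (forall i, continuous (fun y => f y 0 i : R^o)) ->
    closed [set y | orthant (f y)].
  move=> cf y Hy i; suff ci : closed [set z | 0 <= f z 0 i].
    by apply: ci; apply: closureS Hy => z; apply.
  apply: (@preimage_closed E R^o (fun z => f z 0 i) [set z : R | 0 <= z]).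
    by move=> z _; exact: cf.
  exact: closed_ge.
rewrite (_ : L = ([set y | orthant y.1.1] `&` [set y | orthant y.1.2]) `&`
    [set y | (y.2%:E <= U y.1.1)%E]); last first.
  by apply/seteqP; split => y /= [] // [].
apply: closedI; first by apply: closedI; exact: closed_orthant_L.
move=> y Hy /=; rewrite leNgt; apply/negP => Uy.
(* A level separating U from [y.2]. Near [y] the utility is below [c] and the level coordinate above
   it, so [y] is not in the closure of [L]. *)
have [c Uc cy] : exists2 c : R, (U y.1.1 < c%:E)%E & c < y.2.
  move: Uy; case: (U y.1.1) => [u|//|]; last by exists (y.2 - 1); rewrite ?ltNyr// gtrBl.
  by rewrite lte_fin => /midf_lt[uc cy]; exists ((u + y.2) / 2); rewrite ?lte_fin.
have [|B By1 BP] := @U_usc y.1.1 (- c).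
  by rewrite EFinN lteN2.
have [z [Lz [Bz cz]]] : [set y | (y.2%:E <= U y.1.1)%E] `&`
    ([set z : E | B z.1.1] `&` [set z : E | c < z.2]) !=set0.
  apply: Hy; apply: filterI.
    exact: (continuous_position By1).
  exact: (@cvgr_gt R E (nbhs y) _ (fun z : E => z.2) y.2 (@continuous_level y) c cy).
have := BP _ Bz; rewrite EFinN lteN2 => /(le_lt_trans Lz).
by rewrite lte_fin => /(lt_trans cz); rewrite ltxx.
Qed.

Let caratheodory_violation : caratheodory violation.
Proof.
have cs k : caratheodory (slack k).
  apply: caratheodoryD; last first.
    by apply: caratheodory_sum => i; apply: caratheodory_cont; exact: continuous_mu.
  apply: caratheodoryD; last first.
    apply: caratheodory_sum => j; apply: caratheodoryM.
      by apply: caratheodory_cont; exact: continuous_mu.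
    by apply: caratheodory_cst; exact: measurableT_comp.
  apply: caratheodoryD; first exact: caratheodory_cst.
  apply: caratheodory_cont => y; apply: cvgN.
  have -> : (fun z : E => pad0 z.1.1 0 k) =
      (if insub (val k) is Some i then fun z : E => z.1.1 0 i else cst 0).
    by apply/funext => z; rewrite mxE; case: insubP.
  rewrite mxE; case: insub => [i|]; first exact: continuous_xi.
  exact: cvg_cst.
apply: caratheodory_sum => k; apply: caratheodoryD; first exact: caratheodory_norm.
have -> : (fun y w => - slack k y w) = fun y w => (fun=> fun=> -1) y w * slack k y w.
  by apply/funext => y; apply/funext => w; rewrite mulN1r.
apply: caratheodoryM => //.
by apply: caratheodory_cst; exact: measurable_cst.
Qed.

Let violation_ge0 y w : 0 <= violation y w.
Proof. by apply: sumr_ge0 => k _; rewrite subr_ge0 ler_norm. Qed.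

Let violation0P y w : violation y w = 0 <-> forall k, 0 <= slack k y w.
Proof.
split; last first.
  by move=> s0; apply: big1 => k _; rewrite ger0_norm// subrr.
move=> /eqP; rewrite psumr_eq0; last by move=> k _; rewrite subr_ge0 ler_norm.
move=> /allP H k; have /= := H k (mem_index_enum k).
by rewrite subr_eq0 => /eqP <-.
Qed.

Let liquidationsP w xi c : (c%:E <= U xi)%E ->
  liquidations w xi <-> exists y : E, [/\ L y, violation y w = 0, y.1.1 = xi & y.2 = c].
Proof.
move=> cU; split.
  move=> [xi0 /opp_setP /(solvency_coneP D_gt0)[m [m0 Hm]]].
  exists (xi, mxvec (\matrix_(i, j) m i j), c); split => //.
    split => // k /=; case/mxvec_indexP: k => i j.
    by rewrite mxvecE mxE.
  apply/violation0P => k; apply: le_trans (Hm k) _.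
  rewrite le_eqVlt; apply/orP; left; apply/eqP.
  rewrite opprB /slack /mu /= !mxE; congr (_ + _ + _).
    by rewrite -sumrN; apply: eq_bigr => j _; rewrite mxvecE mxE mulrN.
  by apply: eq_bigr => j _; rewrite mxvecE mxE.
move=> [y [[xi0 mu0 _] /violation0P Hy <- _]]; split => //.
apply/opp_setP/(solvency_coneP D_gt0); exists (mu y); split => [i j|k]; first exact: mu0.
apply: le_trans (Hy k) _.
rewrite le_eqVlt; apply/orP; left; apply/eqP.
rewrite opprB /slack !mxE; congr (_ + _ + _).
by rewrite -sumrN; apply: eq_bigr => j _; rewrite mulrN.
Qed.

Let properE : proper_space E.
Proof.
apply: proper_space_prod; last exact: proper_space_R.
by apply: proper_space_prod; exact: proper_space_rV.
Qed.

Let distance_to (a : Omega -> R) (y : E) w := violation y w + `|y.2 - a w|.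

Let caratheodory_distance a : measurable_fun setT a -> caratheodory (distance_to a).
Proof. by move=> ma; apply: caratheodoryD => //; exact: caratheodory_dist. Qed.

Let distance_to0P a y w : distance_to a y w = 0 <-> violation y w = 0 /\ y.2 = a w.
Proof.
split; last by move=> [v0 ya]; rewrite /distance_to v0 ya subrr normr0 addr0.
by move=> /eqP; rewrite paddr_eq0// normr_eq0 subr_eq0 => /andP[/eqP-> /eqP->].
Qed.

Let measurable_level (c : R) :
  measurable [set w | exists2 xi, liquidations w xi & (c%:E <= U xi)%E].
Proof.
rewrite (_ : [set w | _] = [set w | exists2 y, L y & distance_to (cst c) y w = 0]).
  apply: (measurable_exists_zero properE) => //.
    by apply: caratheodory_distance; exact: measurable_cst.
  by move=> y w; rewrite addr_ge0.
apply/seteqP; split => w /=.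
  move=> [xi Lxi cU]; have [y [Ly v0 _ yc]] := (liquidationsP w cU).1 Lxi.
  by exists y => //; apply/distance_to0P.
move=> [y Ly /distance_to0P[v0 yc]]; have [_ _ cU] := Ly; rewrite yc in cU.
by exists y.1.1 => //; apply/(liquidationsP w cU); exists y.
Qed.

Lemma optimal_liquidation_gt (c : R) w : (c%:E < optimal_liquidation w)%E ->
  exists2 xi, liquidations w xi & (c%:E <= U xi)%E.
Proof.
by move=> /ereal_sup_gt[_ [xi Lxi <-] cU]; exists xi => //; exact: ltW.
Qed.

(** The supremum exceeds c iff, for some n, a liquidation reaches the level c + 1/(n+1). This holds
    whether or not the supremum is attained. *)
Lemma measurable_optimal_liquidation : measurable_fun setT optimal_liquidation.
Proof.
apply: (measurability _ (ErealGenOInfty.measurableE R)).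
move=> _ [_ [c ->] <-]; rewrite setTI.
rewrite (_ : _ @^-1` _ = \bigcup_n
    [set w | exists2 xi, liquidations w xi & ((c + n.+1%:R^-1)%:E <= U xi)%E]).
  by apply: bigcup_measurable => n _; exact: measurable_level.
apply/seteqP; split => w /=; rewrite in_itv /= andbT.
  move=> /ereal_sup_gt[_ [xi Lxi <-] cU].
  have [n nU] : exists n : nat, ((c + n.+1%:R^-1)%:E <= U xi)%E.
    move: cU; case: (U xi) => [u||//]; last by exists 0%N; rewrite leey.
    by rewrite lte_fin => /ltr_add_invr[n nu]; exists n; rewrite lee_fin ltW.
  by exists n => //; exists xi.
move=> [n _ [xi Lxi nU]]; apply: (@lt_le_trans _ _ (c + n.+1%:R^-1)%:E).
  by rewrite lte_fin ltrDl.
by apply: le_trans nU _; apply: ereal_sup_ubound; exists xi.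
Qed.

Lemma measurable_liquidation_selection (a : Omega -> R) (A : set Omega) :
  measurable_fun setT a -> measurable A ->
  (forall w, A w -> ((a w)%:E < optimal_liquidation w)%E) ->
  exists xi : Omega -> 'rV[R]_d,
    (forall i, measurable_fun setT (fun w => xi w 0 i)) /\
    forall w, A w -> liquidations w (xi w) /\ ((a w)%:E <= U (xi w))%E.
Proof.
move=> ma mA aM.
(* A nonempty [A] provides a point of [L], needed as a dummy solution outside [A]. *)
have [A0|A0] := pselect (A !=set0); last first.
  exists (fun=> 0); split => [i|w Aw]; first exact: measurable_cst.
  by case: A0; exists w.
have solv w : A w -> exists2 y, L y & distance_to a y w = 0.
  move=> Aw; have [xi Lxi aU] := optimal_liquidation_gt (aM w Aw).
  have [y [Ly v0 _ yc]] := (liquidationsP w aU).1 Lxi.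
  by exists y => //; apply/distance_to0P.
(* With this factor every point of [L] is a zero outside [A], so that zeros exist in every
   scenario. *)
pose r y w := \1_A w * distance_to a y w.
(* Only the coordinates of the position are selected; the exchange volumes need to exist but not to
   be measurable. *)
pose phi j (y : E) : R := if insub j is Some i then y.1.1 0 i else 0.
have [||j|w|m [mm Hm]] := @measurable_selection _ _ Omega E properE L r d phi closed_L.
- apply: caratheodoryM; last exact: caratheodory_distance.
  by apply: caratheodory_cst; exact: measurable_indic.
- by move=> y w; rewrite mulr_ge0// addr_ge0.
- rewrite /phi; case: insub => [i|]; first exact: continuous_xi.
  by move=> y; exact: cvg_cst.
- have [w0 Aw0] := A0; have [y0 Ly0 _] := solv w0 Aw0.
  have [Aw|nAw] := pselect (A w).
    by have [y Ly dy0] := solv w Aw; exists y => //; rewrite /r dy0 mulr0.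
  by exists y0 => //; rewrite /r indicE memNset// mul0r.
exists (fun w => \row_i m i w); split.
  by move=> i; under eq_fun do rewrite mxE; exact: mm.
move=> w Aw; have [y [Ly ry] ym] := Hm w.
have -> : \row_i m i w = y.1.1.
  apply/rowP => i; rewrite mxE -ym// /phi.
  by case: insubP => [i' _ ii'|/negP//]; congr (y.1.1 0 _); apply: val_inj.
move: ry; rewrite /r indicE mem_set// mul1r => /distance_to0P[v0 ya].
have [_ _ aU] := Ly; rewrite ya in aU; split => //.
by apply/(liquidationsP w aU); exists y.
Qed.

End liquidation.

(** * Expectations *)

Section expectation.
Import HBSimple HBNNSimple.
Context {R : realType} {disp : measure_display} {Omega : measurableType disp}.
Variable P : probability Omega R.
Hypothesis P_complete : P.-negligible `<=` @measurable _ Omega.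
Implicit Types X Y : Omega -> \bar R.
Local Open Scope ereal_scope.

(* The integral of a nonnegative function, measurable or not, is a supremum
   over the simple functions below it. *)
Lemma ge0_le_integral_ae X Y : (forall w, 0 <= X w) -> (forall w, 0 <= Y w) ->
  {ae P, forall w, X w <= Y w} -> \int[P]_w X w <= \int[P]_w Y w.
Proof.
move=> X0 Y0 XY; rewrite !ge0_integralTE//; apply: ge_ereal_sup => /= _ [h hX <-].
have mN : measurable (~` [set w | X w <= Y w]) := P_complete XY.
(* By completeness the exceptional set is measurable, so [h] may be set to 0 on it without changing
   its integral. *)
pose h' := proj_nnsfun h (measurableC mN).
have h'E w : h' w = (h w * \1_(~` ~` [set w | X w <= Y w]%E) w)%R by [].
have -> : sintegral P h = sintegral P h'.
  rewrite -!integralT_nnsfun; apply: ae_eq_integral => //.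
  - exact/measurable_EFinP.
  - exact/measurable_EFinP.
  - apply: filterS XY => w XYw _; rewrite h'E setCK indicE mem_set//.
    by rewrite mulr1.
suff h'Y w : (h' w)%:E <= Y w by apply: ereal_sup_ubound; exists h'.
rewrite h'E setCK indicE; have [XYw|] := boolP (w \in _).
  by rewrite mulr1; apply: le_trans (hX w) _; exact: set_mem XYw.
by rewrite mulr0.
Qed.

(** If the negative part of [Y] has infinite integral, so has that of [X], and both expectations are
    -oo by convention. Otherwise positive and negative parts are compared separately. *)
Lemma expect_le_ae X Y : {ae P, forall w, X w <= Y w} -> expect P X <= expect P Y.
Proof.
move=> XY.
have Xn_ge : \int[P]_w Y^\- w <= \int[P]_w X^\- w.
  apply: ge0_le_integral_ae => //; apply: filterS XY => w XYw.
  by rewrite !funenegE ge_max !le_max leeN2 XYw lexx orbT.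
have Xp_le : \int[P]_w X^\+ w <= \int[P]_w Y^\+ w.
  apply: ge0_le_integral_ae => //; apply: filterS XY => w XYw.
  by rewrite !funeposE ge_max !le_max XYw lexx orbT.
rewrite /expect; have [Yoo|_] := eqVneq (\int[P]_w Y^\- w) +oo.
  by rewrite Yoo leye_eq in Xn_ge; rewrite Xn_ge.
case: ifP => _; first exact: leNye.
by rewrite integralE [leRHS]integralE leeB.
Qed.

Lemma expect_fin_ae X : measurable_fun setT X -> expect P X != -oo ->
  {ae P, forall w, -oo < X w}.
Proof.
move=> mX; rewrite /expect; case: ifP => // /negbT Xoo _.
have : P.-integrable setT X^\-.
  apply/integrableP; split; first exact: measurable_funeneg.
  by under eq_integral do rewrite gee0_abs//; rewrite ltey.
move=> /(integrable_ae measurableT); apply: filterS => w /(_ I).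
rewrite funenegE; case: (X w) => [r||] //= _; exact: ltNyr.
Qed.

(** The cap makes the level finite where X = +oo, and subtracting [e] puts it strictly below X, as
    the selection requires. [fine] sends -oo to 0, so the value is meaningful only where -oo < X. *)
Definition truncation (X : Omega -> \bar R) (n : nat) (e : R) (w : Omega) : R :=
  (fine (mine (X w) n%:R%:E) - e)%R.

Lemma measurable_truncation X n e :
  measurable_fun setT X -> measurable_fun setT (truncation X n e).
Proof.
move=> mX; apply: measurable_funB; last exact: measurable_cst.
apply: measurableT_comp; first exact: fine_measurable.
by apply: measurable_mine => //; exact: measurable_cst.
Qed.

Lemma truncation_lt X n e w : (0 < e)%R -> -oo < X w ->
  (truncation X n e w)%:E < X w.
Proof.
rewrite /truncation => e0; case: (X w) => [r _||] //=; last by rewrite ltry.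
rewrite -EFin_min/= lte_fin (@lt_le_trans _ _ (Num.min r n%:R))//.
  by rewrite gtrBl.
by rewrite ge_min lexx.
Qed.

(** Unless the expectation is -oo, the negative part is integrable and only X^+ has to be
    approximated. Its integral is a supremum over simple functions, each bounded by some n and hence
    below min(X^+, n). *)
Lemma expect_le_of_truncations X (u : \bar R) : measurable_fun setT X ->
  (forall n e, (0 < e)%R -> expect P (EFin \o truncation X n e) <= u) ->
  expect P X <= u.
Proof.
move=> mX Hu; have [->|XNy] := eqVneq (expect P X) -oo; first exact: leNye.
have X_gt := expect_fin_ae mX XNy.
move: XNy; rewrite /expect; case: ifP => // /negbT Xnoo _.
set c := \int[P]_w X^\- w in Xnoo.
have c0 : 0 <= c by exact: integral_ge0.
have cfin : c \is a fin_num by rewrite ge0_fin_numE// ltey.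
rewrite integralE -/c leeBlDr//.
apply/lee_addgt0Pr => e e0.
rewrite ge0_integralTE//; apply: ge_ereal_sup => /= _ [h hX <-].
have [n hn] : exists n : nat, forall w, (h w <= n%:R)%R.
  have [M [_ HM]] := simple_bounded h; exists (Num.truncn (M + 1)).+1 => w.
  apply: le_trans (ler_norm _) _; apply: le_trans (HM (M + 1)%R _ w I) _.
    by rewrite ltrDl.
  by rewrite ltW// truncnS_gt.
pose m w := mine (X w) n%:R%:E.
have mm : measurable_fun setT m.
  by apply: measurable_mine => //; exact: measurable_cst.
(* As n >= 0, the cap acts on the positive part only. *)
have mn w : m^\- w = X^\- w.
  by rewrite !funenegE /m oppe_min -maxA (max_idPr (_ : - n%:R%:E <= 0)).
have mp w : m^\+ w = mine (X^\+ w) n%:R%:E.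
  by rewrite !funeposE /m max_minl (max_idPl (_ : 0 <= n%:R%:E)).
have iXn : P.-integrable setT X^\-.
  apply/integrableP; split; first exact: measurable_funeneg.
  by under eq_integral do rewrite gee0_abs//; rewrite ltey.
have im : P.-integrable setT m.
  rewrite (funeposneg m); apply: integrableB => //; last first.
    by rewrite (_ : m^\- = X^\-)//; exact/funext.
  apply: (@le_integrable _ _ _ _ _ measurableT _ (EFin \o cst n%:R)) => //.
  - exact: measurable_funepos.
  - move=> w _; rewrite mp !gee0_abs ?lee_fin//= ?ge_min ?lexx ?orbT//.
    by rewrite le_min funepos_ge0/= lee_fin.
  - exact: finite_measure_integrable_cst.
have ib : P.-integrable setT (EFin \o (fine \o m)).
  apply: le_integrable im => //.
    by apply/measurable_EFinP; exact: measurableT_comp.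
  by move=> w _ /=; case: (m w) => [r||] //=; rewrite normr0 leey.
have Eb : \int[P]_w (fine (m w))%:E = \int[P]_w m^\+ w - c.
  have -> : c = \int[P]_w m^\- w by apply: eq_integral => w _; rewrite mn.
  rewrite -integralE; apply: ae_eq_integral => //.
    by apply/measurable_EFinP; exact: measurableT_comp.
  apply: filterS X_gt => w Xw _; rewrite fineK//.
  by rewrite fin_real// /m lt_min Xw ltNyr gt_min ltry orbT.
have Et : \int[P]_w (truncation X n e w)%:E = \int[P]_w m^\+ w - c - e%:E.
  rewrite -Eb; under eq_integral do rewrite EFinB.
  rewrite integralB_EFin//; last exact: finite_measure_integrable_cst.
  rewrite integral_cst//; congr (_ - _).
  by rewrite -[RHS]mule1; congr (_ * _); exact: probability_setT.
have it : P.-integrable setT (EFin \o truncation X n e).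
  exact: (integrableB measurableT ib (finite_measure_integrable_cst P e measurableT)).
have := Hu n e e0; rewrite /expect ifF; last first.
  by have := integrable_neg_fin_num measurableT it; case: (integral _ _ _).
rewrite /= Et leeBlDr// leeBlDr// addeAC => Hle.
apply: le_trans Hle; rewrite ge0_integralTE//.
apply: ereal_sup_ubound; exists h => //= w; rewrite mp le_min hX/= lee_fin hn.
by [].
Qed.

End expectation.

(** * The two inequalities *)

Section terminal_measurability.
Context {R : realType} {disp : measure_display} {Omega : measurableType disp}.
Variables (P : probability Omega R) (T : R) (F : R -> set (set Omega)).
Hypotheses (T_gt0 : 0 < T) (filF : filtration T F).

(** The sample space equipped with [F T]: measurable selection on this space yields F_T-measurable
    liquidations. *)
Let Omega_T := g_sigma_algebraType (F T).

Lemma terminal_measurableE : @measurable _ Omega_T = F T.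
Proof. exact: (sigma_algebra_id (filtration_terminal T_gt0 filF)). Qed.

Lemma measurable_wrt_terminalP (f : Omega -> R) :
  measurable_wrt setT (F T) f <-> measurable_fun setT (f : Omega_T -> R).
Proof.
split; first by move=> mf _ B mB; rewrite terminal_measurableE; exact: mf.
by move=> mf B mB; rewrite -terminal_measurableE; exact: mf.
Qed.

Lemma terminal_measurable_fun (d' : measure_display) (X : measurableType d')
    (f : Omega -> X) :
  measurable_fun setT (f : Omega_T -> X) -> measurable_fun setT f.
Proof.
move=> mf _ B mB; have TT : 0 <= T <= T by rewrite lexx ltW.
have := mf measurableT B mB; rewrite terminal_measurableE.
exact: (filF.1 T TT).2.
Qed.

Hypothesis F_usual : usual_conditions P T F.

Lemma negligible_terminal : P.-negligible `<=` F T.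
Proof.
move=> A /F_usual.1; apply: filF.2 => //; exact: ltW.
Qed.

(** Where the left limit fails to exist, [left_lim] is an arbitrary value; there [W] is set to 0.
    The exceptional set is null, hence in F_T, and [W] becomes a pointwise limit of F_T-measurable
    functions. *)
Lemma measurable_left_lim_ae (D : nat) (V : R -> Omega -> 'rV[R]_D) :
  predictable T F V ->
  {ae P, forall w, V s w @[s --> T^'-] --> left_lim V T w} ->
  exists W : Omega -> 'rV[R]_D,
    (forall i, measurable_fun setT (fun w : Omega_T => W w 0 i)) /\
    {ae P, forall w, W w = left_lim V T w}.
Proof.
move=> prV cvV.
pose good : set Omega_T := [set w | V s w @[s --> T^'-] --> left_lim V T w].
have mgood : measurable good.
  rewrite -(setCK good); apply: measurableC; rewrite terminal_measurableE.
  exact: negligible_terminal.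
exists (fun w => \1_good w *: left_lim V T w); split; last first.
  by apply: filterS cvV => w cw; rewrite indicE mem_set// scale1r.
move=> i; apply: (@measurable_fun_cvg _ Omega_T R setT
    (fun k w => \1_good w * V (approach T k) w 0 i)).
  move=> k; apply: measurable_funM; first exact: measurable_indic.
  apply/measurable_wrt_terminalP; apply: predictable_measurable_terminal => //.
  by rewrite approach_ge0//= ltW// approach_lt.
move=> w _; rewrite mxE; have [gw|ngw] := pselect (good w).
  apply: cvgMr; apply: cvg_mx_entry.
  exact: (cvg_comp _ _ (approach_cvg T_gt0) gw).
rewrite indicE memNset// mul0r; under eq_cvg do rewrite mul0r.
exact: cvg_cst.
Qed.

End terminal_measurability.

Section positions.
Context {R : realType} {d D : nat}.
Hypotheses (d_le_D : (d <= D)%N) (D_gt0 : (0 < D)%N).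
Variable U : 'rV[R]_d -> \bar R.

Lemma pad0_widen (xi : 'rV[R]_d) (i : 'I_d) : pad0 xi 0 (widen_ord d_le_D i) = xi 0 i.
Proof.
rewrite mxE /=; case: insubP => [j _ ji|/negP[]]; last exact: ltn_ord.
by congr (xi 0 _); exact: val_inj.
Qed.

Lemma orthant_pad0 (xi : 'rV[R]_d) : orthant xi -> orthant (pad0 xi : 'rV[R]_D).
Proof. by move=> xi0 k; rewrite mxE; case: insub. Qed.

Lemma extend_utility_pad0 (xi : 'rV[R]_d) :
  orthant xi -> extend_utility d_le_D U (pad0 xi) = U xi.
Proof.
move=> xi0; rewrite /extend_utility asboolT; last exact: orthant_pad0.
by congr U; apply/rowP => i; rewrite mxE pad0_widen.
Qed.

(** Write l - pad0 xi as (l - v) + (v - pad0 xi), with [xi] the first d coordinates of [v]. The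
    second term consists of the remaining coordinates, which are nonnegative. *)
Lemma extend_utility_le_liquidation (K : 'M[R]_D) (v l : 'rV[R]_D) :
  solvency_cone K (l - v) ->
  (extend_utility d_le_D U v <= ereal_sup [set U xi | xi in
    [set xi | orthant xi /\ opp_set (solvency_cone K) (pad0 xi - l)%R]])%E.
Proof.
move=> Klv; rewrite /extend_utility; case: asboolP => v0; last exact: leNye.
apply: ereal_sup_ubound; eexists; last reflexivity.
split; first by move=> i; rewrite mxE.
apply/opp_setP; rewrite opprB -(subrK v l) -addrA.
apply: solvency_coneD => //; apply: orthant_solvency_cone => // k.
rewrite !mxE; case: insubP => [i _ ik|_]; last by rewrite subr0.
by rewrite mxE (_ : widen_ord _ _ = k) ?subrr//; exact: val_inj.
Qed.

End positions.

Theorem proposition4p3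
  (R : realType) (disp : measure_display) (Omega : measurableType disp)
  (P : probability Omega R) (T : R) (T_gt0 : 0 < T)
  (F : R -> set (set Omega))
  (F_filtration : filtration T F) (F_usual : usual_conditions P T F)
  (d D : nat) (d_ge1 : (1 <= d)%N) (d_le_D : (d <= D)%N)
  (Pi : R -> Omega -> 'M[R]_D)
  (Pi_bid_ask : forall (t : R) w, 0 <= t <= T -> bid_ask (Pi t w))
  (Pi_adapted : adapted T F Pi) (Pi_cadlag : cadlag T Pi)
  (F_left : F_left_T T F = F T)
  (Pi_left : {ae P, forall w, left_lim Pi T w = Pi T w})
  (Zs_nonempty : Zs P T F Pi !=set0)
  (U : 'rV[R]_d -> \bar R)
  (U_utility : utility_function U)
  (U_support : support_cone U = orthant)
  (U_usc : upper_semicontinuous U)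
  (U_strict : strictly_concave_on (interior orthant) U)
  (U_smooth : essentially_smooth U)
  (U_satiable : asymptotically_satiable U)
  (u_finite : exists2 x0 : 'rV[R]_D,
     interior (edom (value_function P T F Pi d_le_D U)) x0 &
     (value_function P T F Pi d_le_D U x0 < +oo)%E)
  (x : 'rV[R]_D) :
  value_function P T F Pi d_le_D U x =
  ereal_sup [set expect P (liquidation_utility T Pi U W) |
             W in preterminal_values P T F Pi x].
Proof.
have D_gt0 : (0 < D)%N by exact: leq_trans d_ge1 d_le_D.
have TT : 0 <= T <= T by rewrite lexx ltW.
have P_complete : P.-negligible `<=` @measurable _ Omega.
  move=> A /(negligible_terminal T_gt0 F_filtration F_usual).
  exact: (F_filtration.1 T TT).2.
apply/eqP; rewrite eq_le; apply/andP; split; apply: ge_ereal_sup.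
  move=> _ [_ [V portV <-] <-].
  apply: (@le_trans _ _
    (expect P (liquidation_utility T Pi U (left_lim V T)))); last first.
    by apply: ereal_sup_ubound; exists (left_lim V T) => //; exists V.
  apply: expect_le_ae => //; have [sfV _ _] := portV.
  have := preterminal_jump_solvent T_gt0 F_filtration D_gt0 Pi_bid_ask Pi_cadlag Pi_left
    Zs_nonempty sfV.
  by apply: filterS => w Kw; exact: extend_utility_le_liquidation.
move=> _ [_ [V portV <-] <-]; have [sfV _ _] := portV; have [prV _ _] := sfV.
have [W [mW WV]] := measurable_left_lim_ae T_gt0 F_filtration F_usual prV
  (ae_cvg_left_lim T_gt0 sfV).
pose Omega_T := g_sigma_algebraType (F T).
have mPi i j : measurable_fun setT (fun w : Omega_T => Pi T w i j).
  by apply/(measurable_wrt_terminalP T_gt0 F_filtration); exact: Pi_adapted.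
pose M : Omega_T -> \bar R := optimal_liquidation U W (Pi T).
have mM_T : measurable_fun setT M by exact: measurable_optimal_liquidation.
have mM : measurable_fun setT (M : Omega -> \bar R).
  exact: terminal_measurable_fun mM_T.
apply: (@le_trans _ _ (expect P M)).
  apply: expect_le_ae => //; apply: filterS WV => w WVw.
  by rewrite /M /optimal_liquidation /liquidations WVw.
(* Once this case is excluded, M > -oo almost surely, so the liquidations selected on that event are
   available in almost every scenario. *)
have [->|MNy] := eqVneq (expect P M) -oo%E; first exact: leNye.
apply: expect_le_of_truncations => // n e e0.
have [xi [mxi Hxi]] : exists xi : Omega_T -> 'rV[R]_d,
    (forall i, measurable_fun setT (fun w => xi w 0 i)) /\
    forall w, (-oo < M w)%E -> liquidations W (Pi T) w (xi w) /\
      ((truncation M n e w)%:E <= U (xi w))%E.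
  apply: (measurable_liquidation_selection D_gt0 U_usc mW mPi
    (A := [set w | (-oo < M w)%E])).
  - exact: measurable_truncation.
  - by rewrite -[X in measurable X]setTI; exact: emeasurable_fun_o_infty.
  - by move=> w Mw; exact: truncation_lt.
have M_gt := expect_fin_ae mM MNy.
pose Y w : 'rV[R]_D := pad0 (xi w).
have portY := portfolio_terminal_change T_gt0 F_filtration F_left D_gt0 Pi_cadlag Pi_left
  (Y := Y) portV.
pose V' := (fun t w => V t w + (T <= t)%R%:R *: (Y w - V T w)) : R -> Omega -> 'rV[R]_D.
rewrite -/V' in portY.
have V'T w : V' T w = Y w by rewrite /V' lexx scale1r addrC subrK.
apply: (@le_trans _ _ (expect P (extend_utility d_le_D U \o V' T))).
  apply: expect_le_ae => //; apply: filterS M_gt => w /Hxi[[xi0 _] aU].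
  by rewrite /= V'T extend_utility_pad0.
apply: ereal_sup_ubound; exists (V' T) => //; exists V' => //.
apply: portY.
- move=> i; apply/(measurable_wrt_terminalP T_gt0 F_filtration).
  have -> : (fun w => Y w 0 i) =
      if insub (val i) is Some j then fun w => xi w 0 j else cst 0.
    by apply/funext => w; rewrite mxE; case: insub.
  case: insub => [j|]; [exact: mxi|exact: measurable_cst].
- by apply: filterS M_gt => w /Hxi[[xi0 _] _]; exact: orthant_pad0.
- apply: filterS (filterI M_gt WV) => w [/Hxi[[_ Kw] _] WVw].
  by move/opp_setP: Kw; rewrite opprB WVw.
Qed.
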